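(* Let $M_1$ and $M_2$ be two disjoint, properly embedded hypersurfaces without boundary in $\mathbb{R}^{n+1}$. Assume that $M_2$ is complete with Ricci curvature satisfying $$\mathrm{Ric}_{M_2}\ge-(n-1)R_0$$ for some constant $R_0>0$. Let $d(x)=\mathrm{dist}(x,M_1)$, and suppose that for every sequence $x_j\in M_2$ with $\lim_{j\to+\infty}d(x_j)=\inf_{x\in M_2}\mathrm{dist}(x,M_1)$ one has $$\limsup_{j\to+\infty}\|A_j\|<+\infty,$$ where $A_j$ denotes the shape operator of $M_1$ at a point $y_j\in M_1$ such that $|x_j-y_j|=d(x_j)$. If $$\sup_{M_2}|\mathbf{H}_{M_2}|<\inf_{M_1}H_{M_1},$$ then $M_2$ cannot lie in the convex side of $M_1$.
   Context: Hypersurfaces are smooth and oriented. $H_M$ denotes the mean curvature function of a hypersurface $M$ (the average of the principal curvatures with respect to the chosen unit normal) and $\mathbf{H}_M$ its mean curvature vector; $\mathrm{dist}$ is the Euclidean distance. Convex side: let $M\subset\mathbb{R}^{n+1}$ be a complete, properly embedded hypersurface with empty boundary whose mean curvature function with respect to a unit normal $\eta$ is positive. $M$ splits $\mathbb{R}^{n+1}$ into two connected components; the convex side of $M$ is the component towards which the mean curvature vector of $M$ points. *)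

(* Defs.v *)
From HB Require Import structures.
From mathcomp Require Import all_boot all_order all_algebra.
From mathcomp Require Import all_classical all_reals all_analysis.
Set Implicit Arguments.
Unset Strict Implicit.
Unset Printing Implicit Defensive.
Import Order.TTheory GRing.Theory Num.Theory.
Import numFieldNormedType.Exports.
Local Open Scope classical_set_scope.
Local Open Scope ring_scope.

(* The library norm on row vectors is the sup norm; it induces the usual
   topology and notion of differentiability, but lengths and distances below
   are Euclidean. *)
Definition dot (R : realType) (m : nat) (u v : 'rV[R]_m) : R :=
  (u *m v^T) 0 0.

Definition enorm (R : realType) (m : nat) (u : 'rV[R]_m) : R :=
  Num.sqrt (dot u u).

Definition eucl_dist (R : realType) (m : nat) (x : 'rV[R]_m) (A : set 'rV[R]_m)
  : R := inf [set enorm (x - y) | y in A].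

Definition pd (R : realType) (n : nat) (V : normedModType R) (i : 'I_n)
  (f : 'rV[R]_n -> V) : 'rV[R]_n -> V := fun u => 'D_(delta_mx 0 i) f u.

(* C^oo on U: iterated partial derivatives of every order are differentiable. *)
Definition smooth_on (R : realType) (n : nat) (V : normedModType R)
  (U : set 'rV[R]_n) (f : 'rV[R]_n -> V) : Prop :=
  forall (s : seq 'I_n) (u : 'rV[R]_n), U u ->
    differentiable (foldr (fun i g => pd i g) f s) u.

(* A regular parametrization of a relatively open part of M: a smooth
   immersion that is a homeomorphism onto its image, which is open in M.
   'J phi u acts on row vectors, v |-> v *m 'J phi u, so its rows are the
   coordinate tangent vectors. *)
Definition is_patch (R : realType) (n : nat) (M : set 'rV[R]_n.+1)
  (U : set 'rV[R]_n) (phi : 'rV[R]_n -> 'rV[R]_n.+1) : Prop :=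
  [/\ open U,
      smooth_on U phi,
      {in U &, injective phi},
      (forall u, U u -> row_free (jacobian phi u)) &
      forall W : set 'rV[R]_n, open W -> W `<=` U ->
        exists2 V : set 'rV[R]_n.+1, open V & phi @` W = M `&` V].

(* A nonempty, properly embedded, smooth hypersurface without boundary,
   oriented by the unit normal [unit_normal]. The record also carries, for each
   point p, a parametrization [chart p] centred at p, in which the geometric
   quantities at p are computed; none of them depends on that choice. *)
Record hypersurface (R : realType) (n : nat) := Hypersurface {
  carrier : set 'rV[R]_n.+1;
  unit_normal : 'rV[R]_n.+1 -> 'rV[R]_n.+1;
  chart_dom : 'rV[R]_n.+1 -> set 'rV[R]_n;
  chart : 'rV[R]_n.+1 -> 'rV[R]_n -> 'rV[R]_n.+1;
  carrier_neq0 : carrier !=set0;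
  (* properness of the inclusion *)
  carrier_proper : forall K, compact K -> compact (carrier `&` K);
  chart_patch : forall p, carrier p -> is_patch carrier (chart_dom p) (chart p);
  chart_dom0 : forall p, carrier p -> chart_dom p 0;
  chart0 : forall p, carrier p -> chart p 0 = p;
  normal_smooth : forall p, carrier p ->
    smooth_on (chart_dom p) (unit_normal \o chart p);
  normal_unit : forall p, carrier p -> enorm (unit_normal p) = 1;
  normal_orth : forall p (v : 'rV[R]_n), carrier p ->
    dot (v *m jacobian (chart p) 0) (unit_normal p) = 0
}.

Section ExtrinsicGeometry.
Variables (R : realType) (n : nat) (M : hypersurface R n).

(* Rows: the coordinate basis of the tangent space of M at p. *)
Definition tangent_frame (p : 'rV[R]_n.+1) : 'M[R]_(n, n.+1) :=
  jacobian (chart M p) 0.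

(* The shape operator A = - d(unit_normal) at p, as a matrix in the coordinate
   basis: shape_mx p *m tangent_frame p = - jacobian (unit_normal M \o chart M p) 0. *)
Definition shape_mx (p : 'rV[R]_n.+1) : 'M[R]_n :=
  - jacobian (unit_normal M \o chart M p) 0 *m pinvmx (tangent_frame p).

(* Operator norm of A for the induced metric on the tangent space. *)
Definition shape_norm (p : 'rV[R]_n.+1) : R :=
  sup [set enorm (v *m shape_mx p *m tangent_frame p) |
       v in [set v : 'rV[R]_n | enorm (v *m tangent_frame p) = 1]].

(* The eigenvalues of A with multiplicity; A is self-adjoint for the induced
   metric, so its characteristic polynomial splits over R and the default
   value is never used for p on M. *)
Definition principal_curvatures (p : 'rV[R]_n.+1) : seq R :=
  xget [::] [set s : seq R |
    char_poly (shape_mx p) = \prod_(k <- s) ('X - k%:P)].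

Definition mean_curvature (p : 'rV[R]_n.+1) : R :=
  (\sum_(k <- principal_curvatures p) k) / n%:R.

Definition mean_curvature_vector (p : 'rV[R]_n.+1) : 'rV[R]_n.+1 :=
  mean_curvature p *: unit_normal M p.

(* Only a connected M can split space into exactly two components. For small
   t > 0 the point p + t H(p) lies on the side to which H(p) points. *)
Definition is_convex_side (W : set 'rV[R]_n.+1) : Prop :=
  [/\ connected (carrier M),
      (exists x y : 'rV[R]_n.+1,
        [/\ ~ carrier M x, ~ carrier M y,
            W = connected_component (~` carrier M) x,
            W <> connected_component (~` carrier M) y &
            ~` carrier M = W `|` connected_component (~` carrier M) y]) &
      forall p : 'rV[R]_n.+1, carrier M p ->
        \forall t \near (0 : R)^'+, W (p + t *: mean_curvature_vector p)].

End ExtrinsicGeometry.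

Section IntrinsicGeometry.
Variables (R : realType) (n : nat) (M : hypersurface R n).
Implicit Types (p : 'rV[R]_n.+1) (u : 'rV[R]_n) (i j k : 'I_n).

(* The induced Riemannian metric in the chart at p. *)
Definition metric p u : 'M[R]_n :=
  jacobian (chart M p) u *m (jacobian (chart M p) u)^T.

Definition dmetric p i j k u : R := pd i (fun w => metric p w j k) u.

(* christoffel p k i j is Gamma^k_ij *)
Definition christoffel p k i j u : R :=
  2^-1 * \sum_(l < n) invmx (metric p u) k l *
    (dmetric p i j l u + dmetric p j i l u - dmetric p l i j u).

Definition dchristoffel p (l k i j : 'I_n) u : R :=
  pd l (christoffel p k i j) u.

(* The Ricci tensor at p in the coordinate basis, normalised so that round
   spheres have positive Ricci curvature. *)
Definition ricci p : 'M[R]_n := \matrix_(i, j)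
  (\sum_(k < n) (dchristoffel p k k i j 0 - dchristoffel p j k i k 0)
   + \sum_(k < n) \sum_(l < n)
       (christoffel p k k l 0 * christoffel p l i j 0
        - christoffel p k j l 0 * christoffel p l i k 0)).

Definition ricci_ge (c : R) : Prop :=
  forall p (v : 'rV[R]_n), carrier M p ->
    c * (v *m metric p 0 *m v^T) 0 0 <= (v *m ricci p *m v^T) 0 0.

Definition arc_length (gamma : R -> 'rV[R]_n.+1) : \bar R :=
  \int[lebesgue_measure]_(t in `[(0 : R), 1]) (enorm (derive1 gamma t))%:E.

(* Velocities may vanish, so this class contains a reparametrization of every
   piecewise C^1 curve. *)
Definition is_path (gamma : R -> 'rV[R]_n.+1) (x y : 'rV[R]_n.+1) : Prop :=
  [/\ (forall t, derivable gamma t 1),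
      continuous (derive1 gamma),
      (forall t, 0 <= t <= 1 -> carrier M (gamma t)),
      gamma 0 = x & gamma 1 = y].

(* +oo when x and y lie in different components of M *)
Definition geodesic_dist (x y : 'rV[R]_n.+1) : \bar R :=
  ereal_inf [set arc_length gamma | gamma in [set gamma | is_path gamma x y]].

Definition is_complete : Prop :=
  forall x : nat -> 'rV[R]_n.+1, (forall j, carrier M (x j)) ->
    (forall e : R, 0 < e -> exists N, forall i j,
       (N <= i)%N -> (N <= j)%N -> (geodesic_dist (x i) (x j) < e%:E)%E) ->
    exists2 p, carrier M p & forall e : R, 0 < e -> exists N, forall j,
       (N <= j)%N -> (geodesic_dist (x j) p < e%:E)%E.

End IntrinsicGeometry.

(* Main.v *)
Require Import Defs.
From HB Require Import structures.
From mathcomp Require Import all_boot all_order all_algebra.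
From mathcomp Require Import all_classical all_reals all_analysis.
From mathcomp Require Import complex.
From mathcomp Require Import ring lra.
Set Implicit Arguments.
Unset Strict Implicit.
Unset Printing Implicit Defensive.
Import Order.TTheory GRing.Theory Num.Theory.
Import numFieldNormedType.Exports.
Local Open Scope classical_set_scope.
Local Open Scope ring_scope.

(** Let d be the distance to M1, and suppose that M2 lies in the convex side of
    M1.  The infimum of d on M2 need not be attained, but M2 meets every ball
    of the ambient space in a compact set, so d + eps * rho with
    rho(x) = sqrt (1 + |x|^2) attains its minimum on M2 at some point x, for
    every eps > 0 ([perturbed_distance_min]).  As eps tends to 0 these points
    minimise d ([perturbed_min_minimizing]), hence they have nearest points y
    in M1 at which the shape operators of M1 stay bounded.  The penalty rho is
    harmless because it has bounded derivatives in space and M2 has bounded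
    mean curvature: it perturbs the inequalities below by O(eps) only.

    The pair (x, y) minimises |x' - y'| + eps * rho(x') over M2 x M1.  Let nu
    be the unit vector from y to x.  To first order nu is normal to M1 at y,
    and nu + k * x with k = eps / rho(x) is normal to M2 at x, equal to m * e2
    for the unit normal e2 of M2 and a number m with 1 - eps <= |m| <= 1 + eps.
    To second order, move x with velocity a tangent to M2 and y with velocity
    b, the projection of a along nu onto the tangent space of M1.  Then x - y
    moves, to first order, along nu only, and no term with |x - y| in the
    denominator survives; this matters because |x - y| may tend to 0.  What
    remains ([second_variation]) is
      II_1 (b, b) <= m * II_2 (a, a) + k * |a|^2.
    Sum over an orthonormal basis of vectors a ([trace_comparison]).  The right
    side gives m * n * H_2 + k * n.  The vectors b are not quite orthonormal:
    the left side is n * H_1 - II_1 (r, r), with r the tangential part of e2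
    at y.  The two tangent spaces differ by O(eps), so |r| = O(eps) and the
    bound on the shape operator of M1 makes II_1 (r, r) = O(eps^2).  Letting
    eps tend to 0 gives inf H_1 <= sup |H_2|, against the hypothesis.

    The sign of H_1 above requires nu to be the chosen unit normal of M1 and
    not its opposite, and this is where the convex side enters
    ([side_normal]).  Below M1, that is opposite to its mean curvature vector,
    lies the other component of the complement: the two local sides of M1 are
    locally constant along M1, M1 is connected, and at the nearest point of M1
    to a point of the other component the lower side is in that component.

    The mean curvature is defined from the roots of the characteristic
    polynomial of the shape operator.  It is a trace because the second
    fundamental form is symmetric (equality of mixed derivatives), so that this
    polynomial splits ([symmetric_pencil_split]). *)

(** * The Euclidean inner product *)

Section Dot.
Variable R : realType.
Implicit Types m : nat.

Lemma dotE m (u v : 'rV[R]_m) : dot u v = \sum_i u 0 i * v 0 i.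
Proof. by rewrite /dot mxE; apply: eq_bigr => i _; rewrite mxE. Qed.

Lemma dotC m (u v : 'rV[R]_m) : dot u v = dot v u.
Proof. by rewrite !dotE; apply: eq_bigr => i _; rewrite mulrC. Qed.

Lemma dotDl m (u v w : 'rV[R]_m) : dot (u + v) w = dot u w + dot v w.
Proof. by rewrite /dot mulmxDl mxE. Qed.

Lemma dotDr m (u v w : 'rV[R]_m) : dot w (u + v) = dot w u + dot w v.
Proof. by rewrite dotC dotDl !(dotC w). Qed.

Lemma dotZl m k (u v : 'rV[R]_m) : dot (k *: u) v = k * dot u v.
Proof. by rewrite /dot -scalemxAl mxE. Qed.

Lemma dotZr m k (u v : 'rV[R]_m) : dot u (k *: v) = k * dot u v.
Proof. by rewrite dotC dotZl dotC. Qed.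

Lemma dotNl m (u v : 'rV[R]_m) : dot (- u) v = - dot u v.
Proof. by rewrite -scaleN1r dotZl mulN1r. Qed.

Lemma dotNr m (u v : 'rV[R]_m) : dot u (- v) = - dot u v.
Proof. by rewrite dotC dotNl dotC. Qed.

Lemma dotBl m (u v w : 'rV[R]_m) : dot (u - v) w = dot u w - dot v w.
Proof. by rewrite dotDl dotNl. Qed.

Lemma dotBr m (u v w : 'rV[R]_m) : dot w (u - v) = dot w u - dot w v.
Proof. by rewrite dotDr dotNr. Qed.

Lemma dot0l m (v : 'rV[R]_m) : dot 0 v = 0.
Proof. by rewrite /dot mul0mx mxE. Qed.

Lemma dot0r m (v : 'rV[R]_m) : dot v 0 = 0.
Proof. by rewrite dotC dot0l. Qed.

Lemma dot_mulmx m k (u : 'rV[R]_m) (A : 'M[R]_(m, k)) (v : 'rV[R]_k) :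
  dot (u *m A) v = dot u (v *m A^T).
Proof. by rewrite /dot trmx_mul trmxK mulmxA. Qed.

Lemma dot_ge0 m (u : 'rV[R]_m) : 0 <= dot u u.
Proof. by rewrite dotE; apply: sumr_ge0 => i _; rewrite -expr2 sqr_ge0. Qed.

Lemma dot_eq0 m (u : 'rV[R]_m) : (dot u u == 0) = (u == 0).
Proof.
apply/eqP/eqP => [|->]; last exact: dot0l.
rewrite dotE => /eqP; rewrite psumr_eq0 => [/allP u0|i _]; last first.
  by rewrite -expr2 sqr_ge0.
apply/rowP => i; rewrite mxE; have := u0 i (mem_index_enum i).
by rewrite -expr2 sqrf_eq0 => /eqP.
Qed.

Lemma dot_gt0 m (u : 'rV[R]_m) : u != 0 -> 0 < dot u u.
Proof. by move=> u0; rewrite lt_neqAle dot_ge0 eq_sym dot_eq0 u0. Qed.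

Lemma enorm_ge0 m (u : 'rV[R]_m) : 0 <= enorm u.
Proof. exact: sqrtr_ge0. Qed.

Lemma enorm_sqr m (u : 'rV[R]_m) : enorm u ^+ 2 = dot u u.
Proof. by rewrite sqr_sqrtr ?dot_ge0. Qed.

Lemma enorm_eq0 m (u : 'rV[R]_m) : (enorm u == 0) = (u == 0).
Proof. by rewrite -dot_eq0 -enorm_sqr sqrf_eq0. Qed.

Lemma enorm_gt0 m (u : 'rV[R]_m) : u != 0 -> 0 < enorm u.
Proof. by move=> u0; rewrite lt_neqAle enorm_ge0 eq_sym enorm_eq0 u0. Qed.

Lemma enorm0 m : enorm (0 : 'rV[R]_m) = 0.
Proof. by apply/eqP; rewrite enorm_eq0. Qed.

Lemma enormZ m k (u : 'rV[R]_m) : enorm (k *: u) = `|k| * enorm u.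
Proof.
by rewrite /enorm dotZl dotZr mulrA -expr2 sqrtrM ?sqr_ge0// sqrtr_sqr.
Qed.

Lemma enormN m (u : 'rV[R]_m) : enorm (- u) = enorm u.
Proof. by rewrite -scaleN1r enormZ normrN1 mul1r. Qed.

Lemma enormBC m (u v : 'rV[R]_m) : enorm (u - v) = enorm (v - u).
Proof. by rewrite -enormN opprB. Qed.

Lemma dot_le_enorm m (u v : 'rV[R]_m) : dot u v <= enorm u * enorm v.
Proof.
have [->|v0] := eqVneq v 0; first by rewrite dot0r enorm0 mulr0.
have [->|u0] := eqVneq u 0; first by rewrite dot0l enorm0 mul0r.
have pu := enorm_gt0 u0; have pv := enorm_gt0 v0.
have := dot_ge0 (enorm v *: u - enorm u *: v).
rewrite dotBl !dotBr !dotZl !dotZr -!enorm_sqr (dotC v u) => H.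
have : 0 <= 2 * (enorm u * enorm v) * (enorm u * enorm v - dot u v) by nra.
by rewrite pmulr_rge0 ?subr_ge0// !mulr_gt0.
Qed.

Lemma normr_dot_le m (u v : 'rV[R]_m) : `|dot u v| <= enorm u * enorm v.
Proof.
rewrite ler_norml dot_le_enorm andbT lerNl -dotNl -[enorm u]enormN.
exact: dot_le_enorm.
Qed.

Lemma ler_enormD m (u v : 'rV[R]_m) : enorm (u + v) <= enorm u + enorm v.
Proof.
rewrite -(@ler_pXn2r _ 2) ?nnegrE ?addr_ge0 ?enorm_ge0// sqrrD !enorm_sqr.
rewrite dotDl !dotDr (dotC v u) mulr2n.
by have := dot_le_enorm u v; lra.
Qed.

Lemma ler_enormB m (u v w : 'rV[R]_m) :
  enorm (u - w) <= enorm (u - v) + enorm (v - w).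
Proof. by rewrite (le_trans _ (ler_enormD _ _))// subrKA. Qed.

Lemma normr_coord_le m (u : 'rV[R]_m) i : `|u 0 i| <= `|u|.
Proof.
rewrite [X in _ <= X]/Num.norm/= mx_normrE.
exact: (le_bigmax _ (fun ij => `|u ij.1 ij.2|) (0, i)).
Qed.

Lemma normr_le_enorm m (u : 'rV[R]_m) : `|u| <= enorm u.
Proof.
rewrite /Num.norm/= mx_normrE; apply: bigmax_le; first exact: enorm_ge0.
move=> [i j] _ /=; rewrite ord1 -(@ler_pXn2r _ 2) ?nnegrE ?enorm_ge0// enorm_sqr.
rewrite real_normK ?num_real// dotE (bigD1 j)//= -expr2 lerDl.
by apply: sumr_ge0 => k _; rewrite -expr2 sqr_ge0.
Qed.

Lemma enorm_le_normr m (u : 'rV[R]_m) : enorm u <= m%:R * `|u|.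
Proof.
rewrite -(@ler_pXn2r _ 2) ?nnegrE ?mulr_ge0 ?enorm_ge0// enorm_sqr.
case: m => [|m] in u *; first by rewrite [u]thinmx0 dot0l sqr_ge0.
rewrite exprMn dotE; apply: (@le_trans _ _ (\sum_(i < m.+1) `|u| ^+ 2)).
  apply: ler_sum => i _; rewrite -expr2 -real_normK ?num_real//.
  by rewrite ler_pXn2r ?nnegrE//; exact: normr_coord_le.
rewrite sumr_const card_ord -[X in X <= _]mulr_natl ler_wpM2r ?sqr_ge0//.
by rewrite expr2 ler_peMl// ler1n.
Qed.

Lemma enorm_mulmx_le m k (A : 'M[R]_(m, k)) :
  exists2 K, 0 < K & forall u : 'rV[R]_m, enorm (u *m A) <= K * enorm u.
Proof.
exists (1 + \sum_i enorm (row i A)).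
  by rewrite ltr_pwDl// sumr_ge0// => i _; exact: enorm_ge0.
move=> u; rewrite mulmx_sum_row.
apply: (@le_trans _ _ (\sum_i `|u 0 i| * enorm (row i A))).
  elim/big_ind2: _ => [|a x b y ax ay|i _]; first by rewrite enorm0.
  - by rewrite (le_trans (ler_enormD _ _))// lerD.
  - by rewrite enormZ.
rewrite mulrDl mul1r -[leLHS]add0r lerD ?enorm_ge0// mulr_suml.
apply: ler_sum => i _; rewrite mulrC ler_wpM2l ?enorm_ge0//.
exact: le_trans (normr_coord_le u i) (normr_le_enorm u).
Qed.

End Dot.

(** * Symmetric pencils and traces *)

Section Pencil.
Variable R : realType.

Lemma trace_split n (A : 'M[R]_n) (s : seq R) :
  char_poly A = \prod_(k <- s) ('X - k%:P) -> \tr A = \sum_(k <- s) k.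
Proof.
move=> As.
have sn : size s = n.
  have := size_char_poly A; rewrite As size_prod_XsubC => -[]; exact.
case: n => [|n] in A As sn *.
  by case: s sn {As} => //; rewrite big_nil /mxtrace big_ord0.
have := char_poly_trace A (ltn0Sn n).
rewrite As -[X in X.-1]sn coefPn_prod_XsubC ?sn// => /eqP.
by rewrite eqr_opp => /eqP.
Qed.

Lemma sym_form_comm n (A : 'M[R]_n) (a b : 'rV[R]_n) : A^T = A ->
  dot (a *m A) b = dot (b *m A) a.
Proof. by move=> As; rewrite dot_mulmx As dotC. Qed.

(** An eigenvector over the complex numbers has a real eigenvalue, by the usual
    computation with its real and imaginary parts; hence all roots of the
    characteristic polynomial are real.  Working with the pencil (A, G) avoids
    choosing an orthonormal basis for [G]. *)
Lemma symmetric_pencil_split n (A G : 'M[R]_n) :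
  A^T = A -> G^T = G ->
  (forall v : 'rV[R]_n, v != 0 -> 0 < dot (v *m G) v) ->
  exists s : seq R, char_poly (A *m invmx G) = \prod_(k <- s) ('X - k%:P) /\
    forall k, k \in s -> exists2 v : 'rV[R]_n, v != 0 & v *m A = k *: (v *m G).
Proof.
move=> As Gs Gpos.
have Gu : G \in unitmx.
  rewrite -row_free_unit -kermx_eq0; apply/eqP/row_matrixP => i; rewrite row0.
  apply/eqP/negP => /negP/Gpos; rewrite -row_mul mulmx_ker row0 dot0l.
  by rewrite ltxx.
set B := A *m invmx G.
have BG : B *m G = A by rewrite /B mulmxKV.
pose rc : {rmorphism R -> complex R} := real_complex R.
pose p := char_poly B.
have [r pr] := closed_field_poly_normal (char_poly (map_mx rc B)).
move: pr; rewrite (monicP (char_poly_monic _)) scale1r => pr.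
have rreal z : z \in r -> z = rc (complex.Re z).
  move=> zr.
  have : root (char_poly (map_mx rc B)) z by rewrite pr root_prod_XsubC.
  rewrite -eigenvalue_root_char => /eigenvalueP[v vB v0].
  have vA : v *m map_mx rc A = z *: (v *m map_mx rc G).
    by rewrite -BG map_mxM mulmxA vB scalemxAl.
  pose a := \row_i complex.Re (v 0 i); pose b := \row_i complex.Im (v 0 i).
  have ReM C : map_mx (@complex.Re R) (v *m map_mx rc C) = a *m C.
    apply/rowP => i; rewrite !mxE (big_morph (@complex.Re R) (id1 := 0) (op1 := +%R))//.
      by apply: eq_bigr => j _; rewrite !mxE; case: (v 0 j) => ? ? /=; rewrite mulr0 subr0.
    by case=> ? ? [].
  have ImM C : map_mx (@complex.Im R) (v *m map_mx rc C) = b *m C.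
    apply/rowP => i; rewrite !mxE (big_morph (@complex.Im R) (id1 := 0) (op1 := +%R))//.
      by apply: eq_bigr => j _; rewrite !mxE; case: (v 0 j) => ? ? /=; rewrite mulr0 add0r.
    by case=> ? ? [].
  case: z => x y in zr vB vA *.
  have aA : a *m A = x *: (a *m G) - y *: (b *m G).
    rewrite -ReM vA -ReM -ImM; apply/rowP => i; rewrite !mxE.
    by case: (\sum_j _).
  have bA : b *m A = x *: (b *m G) + y *: (a *m G).
    rewrite -ImM vA -ReM -ImM; apply/rowP => i; rewrite !mxE.
    by case: (\sum_j _).
  have := sym_form_comm a b As; rewrite aA bA dotBl dotDl !dotZl.
  rewrite (sym_form_comm a b Gs) => /eqP; rewrite -subr_eq0 => /eqP H.
  have {}H : y * (dot (a *m G) a + dot (b *m G) b) = 0.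
    rewrite -[RHS]oppr0 -[X in - X]H; ring.
  have Gge u : 0 <= dot (u *m G) u.
    have [->|/Gpos/ltW//] := eqVneq u 0; by rewrite dot0r.
  have pos : 0 < dot (a *m G) a + dot (b *m G) b.
    have [a0|/Gpos a0] := eqVneq a 0; last by rewrite ltr_pwDl.
    have [b0|/Gpos b0] := eqVneq b 0; last by rewrite ltr_wpDl.
    case/negP: v0; apply/eqP/rowP => i; rewrite mxE.
    move/rowP: a0 => /(_ i); move/rowP: b0 => /(_ i); rewrite !mxE.
    by case: (v 0 i) => ? ? /= -> ->.
  by move/eqP: H; rewrite mulf_eq0 (gt_eqF pos) orbF => /eqP ->.
exists (map (@complex.Re R) r); split.
  apply: (map_inj_poly (f := rc)) => //; first exact: fmorph_inj.
  rewrite map_char_poly pr rmorph_prod big_map /= big_seq [RHS]big_seq.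
  apply: eq_bigr => z /rreal zE.
  by rewrite rmorphB/= map_polyX map_polyC/= -zE.
move=> k /mapP[z zr ->].
have : root (char_poly B) (complex.Re z).
  rewrite -(fmorph_root rc) map_char_poly pr root_prod_XsubC -rreal//.
rewrite -eigenvalue_root_char => /eigenvalueP[v vB v0]; exists v => //.
by rewrite -BG mulmxA vB scalemxAl.
Qed.

(** Each eigenvalue k of the pencil is a quotient of values of the two forms:
    v A v^T = k * v G v^T for an eigenvector v. *)
Lemma pencil_trace_ge0 n (A G : 'M[R]_n) :
  A^T = A -> G^T = G ->
  (forall v : 'rV[R]_n, v != 0 -> 0 < dot (v *m G) v) ->
  (forall v : 'rV[R]_n, 0 <= dot (v *m A) v) ->
  0 <= \tr (A *m invmx G).
Proof.
move=> As Gs Gpos Aps; have [s [sE sP]] := symmetric_pencil_split As Gs Gpos.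
rewrite (trace_split sE) big_seq; apply: sumr_ge0 => k /sP[v v0 vA].
by have := Aps v; rewrite vA dotZl pmulr_lge0// Gpos.
Qed.

End Pencil.

Section Frames.
Variables (R : realType) (n : nat).
Implicit Types (T : 'M[R]_(n, n.+1)) (e : 'rV[R]_n.+1).

Lemma row_free_mul_eq0 T (v : 'rV[R]_n) : row_free T -> (v *m T == 0) = (v == 0).
Proof.
move=> Tf; apply/eqP/eqP => [|->]; last by rewrite mul0mx.
by rewrite -[0](mul0mx _ T) => /(row_free_inj Tf).
Qed.

Lemma gram_form T (v : 'rV[R]_n) :
  dot (v *m (T *m T^T)) v = dot (v *m T) (v *m T).
Proof. by rewrite /dot trmx_mul !mulmxA. Qed.

Lemma gram_sym T : (T *m T^T)^T = T *m T^T.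
Proof. by rewrite trmx_mul trmxK. Qed.

Lemma gram_pos T (v : 'rV[R]_n) : row_free T -> v != 0 ->
  0 < dot (v *m (T *m T^T)) v.
Proof. by move=> Tf v0; rewrite gram_form dot_gt0// row_free_mul_eq0. Qed.

Lemma gram_unit T : row_free T -> T *m T^T \in unitmx.
Proof.
move=> Tf; rewrite -row_free_unit -kermx_eq0; apply/eqP/row_matrixP => i.
rewrite row0; apply/eqP/negP => /negP/(gram_pos Tf).
by rewrite -row_mul mulmx_ker row0 dot0l ltxx.
Qed.

Lemma dot_row0 T e : (forall v : 'rV[R]_n, dot (v *m T) e = 0) -> T *m e^T = 0.
Proof.
move=> Te; apply/row_matrixP => i; rewrite row0 row_mul rowE; apply/rowP => j.
by rewrite ord1 [RHS]mxE -[LHS]/(dot _ _) Te.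
Qed.

(** The left side is the orthogonal projection onto the row space of [T], whose
    orthogonal complement is spanned by [e] for reasons of dimension. *)
Lemma tangent_normal_resolution T e : row_free T -> T *m e^T = 0 -> dot e e = 1 ->
  T^T *m invmx (T *m T^T) *m T = 1%:M - e^T *m e.
Proof.
move=> Tf Te ee; set P := _ *m T; have Gu := gram_unit Tf.
have ee1 : e *m e^T = 1%:M by rewrite [LHS]mx11_scalar -/(dot e e) ee.
have eT : e *m T^T = 0 by rewrite -[e]trmxK -trmx_mul Te trmx0.
pose D := P - (1%:M - e^T *m e).
have TD : T *m D = 0.
  rewrite /D /P !mulmxBr mulmx1 !mulmxA Te mul0mx subr0 mulmxV// mul1mx subrr.
  by [].
have eD : e *m D = 0.
  by rewrite /D /P !mulmxBr mulmx1 !mulmxA eT !mul0mx ee1 mul1mx subrr subr0.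
(* [D] is killed by an invertible matrix, the frame completed by the normal. *)
have Fu : row_free (col_mx e T).
  rewrite -kermx_eq0; apply/eqP/row_matrixP => i; rewrite row0.
  set w := row i _; have : w *m col_mx e T = 0 by rewrite -row_mul mulmx_ker row0.
  rewrite -[w]hsubmxK mul_row_col; set a := lsubmx w; set b := rsubmx w => H.
  have a0 : a = 0.
    have : (a *m e + b *m T) *m e^T = 0 by rewrite H mul0mx.
    by rewrite mulmxDl -!mulmxA Te ee1 mulmx1 mulmx0 addr0.
  move: H; rewrite a0 mul0mx add0r => /eqP; rewrite row_free_mul_eq0// => /eqP->.
  by rewrite row_mx0.
have : col_mx e T *m D = 0 by rewrite mul_col_mx eD TD col_mx0.
have {}Fu : (col_mx e T : 'M[R]_n.+1) \in unitmx by rewrite -row_free_unit.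
move=> H; have : D = 0 by rewrite -[D](mulKmx Fu) [X in _ *m X]H mulmx0.
by move/eqP; rewrite subr_eq0 => /eqP.
Qed.

(** Geometrically, [T1] and [T2] are frames of two hyperplanes with unit normals
    [e1] and [e2], and w T1 is the projection of v T2 to the first hyperplane.
    Summing the hypothesis over an orthonormal basis of the second hyperplane
    is taking the trace of a nonnegative form against the metric of [T2].  For
    the left side, extend [h1] to a form A on the ambient space that vanishes
    on [e1]; its sum over the second hyperplane is tr A - A (e2, e2),
    where A (e2, e2) is the value of [h1] at the tangential part of [e2]. *)
Lemma trace_comparison (T1 T2 : 'M[R]_(n, n.+1)) (e1 e2 : 'rV[R]_n.+1)
    (h1 h2 : 'M[R]_n) (m k : R) :
  row_free T1 -> row_free T2 -> T1 *m e1^T = 0 -> T2 *m e2^T = 0 ->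
  dot e1 e1 = 1 -> dot e2 e2 = 1 -> h1^T = h1 -> h2^T = h2 ->
  (forall v w : 'rV[R]_n, w *m T1 = v *m T2 - dot (v *m T2) e1 *: e1 ->
     dot (w *m h1) w <= m * dot (v *m h2) v + k * dot (v *m T2) (v *m T2)) ->
  exists2 r : 'rV[R]_n, r *m T1 = e2 - dot e2 e1 *: e1 &
    \tr (h1 *m invmx (T1 *m T1^T)) - dot (r *m h1) r
      <= m * \tr (h2 *m invmx (T2 *m T2^T)) + k * n%:R.
Proof.
move=> T1f T2f Te1 Te2 e11 e22 h1s h2s H.
set G1 := T1 *m _; set G2 := T2 *m _.
have G1u : G1 \in unitmx := gram_unit T1f.
have G2u : G2 \in unitmx := gram_unit T2f.
have G1s : (invmx G1)^T = invmx G1 by rewrite trmx_inv gram_sym.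
have proj p (X : 'M[R]_(p, n.+1)) :
    X *m T1^T *m invmx G1 *m T1 = X - X *m e1^T *m e1.
  rewrite -!mulmxA (mulmxA T1^T) (tangent_normal_resolution T1f Te1 e11).
  by rewrite mulmxBr mulmx1 !mulmxA.
have projr (u : 'rV[R]_n.+1) :
    u *m T1^T *m invmx G1 *m T1 = u - dot u e1 *: e1.
  by rewrite proj [u *m _]mx11_scalar mul_scalar_mx.
exists (e2 *m T1^T *m invmx G1); first exact: projr.
pose B := T2 *m T1^T *m invmx G1.
(* [B] is the matrix of the projection v |-> w. *)
pose Q := m *: h2 + k *: G2 - B *m h1 *m B^T.
have BTE : B^T = invmx G1 *m T1 *m T2^T by rewrite !trmx_mul G1s trmxK mulmxA.
have Qs : Q^T = Q.
  rewrite /Q linearB linearD !linearZ /= h2s gram_sym.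
  by rewrite trmx_mul trmxK [(B *m h1)^T]trmx_mul h1s mulmxA.
have Qge v : 0 <= dot (v *m Q) v.
  have /H := projr (v *m T2); rewrite -!(mulmxA v) -/B => Hv.
  rewrite /Q mulmxBr mulmxDr dotBl dotDl -!scalemxAr !dotZl gram_form.
  by rewrite subr_ge0 (mulmxA v (B *m h1)) [leLHS]dot_mulmx trmxK.
have := pencil_trace_ge0 Qs (gram_sym T2) (fun v => gram_pos T2f) Qge.
rewrite -/G2 /Q mulmxBl mulmxDl linearB linearD /= -!scalemxAl !linearZ /=.
rewrite mulmxV// mxtrace1 subr_ge0 => /(le_trans _); apply.
(* The extension of [h1] by 0 to the ambient space. *)
pose A := T1^T *m invmx G1 *m h1 *m invmx G1 *m T1.
have trA : \tr A = \tr (h1 *m invmx G1).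
  by rewrite /A mxtrace_mulC !mulmxA mulmxV// mul1mx.
have -> : \tr (B *m h1 *m B^T *m invmx G2) = \tr A - \tr (A *m (e2^T *m e2)).
  have -> : \tr A - \tr (A *m (e2^T *m e2)) = \tr (A *m (1%:M - e2^T *m e2)).
    by rewrite mulmxBr mulmx1 linearB.
  rewrite -(tangent_normal_resolution T2f Te2 e22) -/G2 BTE /B /A.
  rewrite -!mulmxA mxtrace_mulC; congr (\tr _).
  by rewrite -!mulmxA.
rewrite trA lerB// le_eqVlt; apply/orP; left; apply/eqP.
rewrite mulmxA mxtrace_mulC /mxtrace big_ord1 /A /dot !trmx_mul G1s trmxK.
by rewrite !mulmxA.
Qed.

End Frames.

(** * Second-order calculus *)

Section Calculus.
Variable R : realType.

Lemma is_derive_coord (V : normedModType R) m k (f : V -> 'M[R]_(m, k)) x v df i j :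
  is_derive x v f df -> is_derive x v (fun y => f y i j) (df i j).
Proof.
case=> fd <-; apply: DeriveDef; first exact: (derivable_mxP _ _ _).1.
by rewrite derive_mx// mxE.
Qed.

Lemma is_derive_dot (V : normedModType R) m (f g : V -> 'rV[R]_m) x v df dg :
  is_derive x v f df -> is_derive x v g dg ->
  is_derive x v (fun y => dot (f y) (g y)) (dot df (g x) + dot (f x) dg).
Proof.
move=> fd gd; have -> : (fun y => dot (f y) (g y)) =
    \sum_i ((fun y => f y 0 i) * (fun y => g y 0 i)).
  by apply/funext => y; rewrite dotE fct_sumE.
apply: is_derive_eq.
  apply: is_derive_sum => i; apply: is_deriveM; exact: is_derive_coord.
rewrite !dotE -big_split; apply: eq_bigr => i _ /=.
rewrite /GRing.scale/=; ring.
Qed.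

Lemma differentiable_dotl (V : normedModType R) m (f : V -> 'rV[R]_m) xi x :
  differentiable f x -> differentiable (fun y => dot (f y) xi) x.
Proof.
move=> fd; have -> : (fun y => dot (f y) xi) =
    \sum_i (xi 0 i \*: (fun y => f y 0 i)).
  apply/funext => y; rewrite dotE fct_sumE; apply: eq_bigr => i _.
  by rewrite /= mulrC.
apply: differentiable_sum => i; apply: differentiableZ.
exact: (differentiable_comp fd (differentiable_coord _ _ _)).
Qed.

Lemma cvg_dot (T : Type) (F : set_system T) m (f g : T -> 'rV[R]_m) a b :
  Filter F -> f @ F --> a -> g @ F --> b -> dot (f x) (g x) @[x --> F] --> dot a b.
Proof.
move=> FF fa gb; have -> : (fun x => dot (f x) (g x)) =
    \sum_i ((fun x => f x 0 i) * (fun x => g x 0 i)).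
  by apply/funext => y; rewrite dotE fct_sumE.
rewrite dotE; elim/big_ind2: _ => [|h l h' l' hl h'l'|i _].
- exact: cvg_cst.
- exact: cvgD.
- apply: cvgM; first exact: (cvg_comp _ _ fa (@coord_continuous _ _ _ _ _ _)).
  exact: (cvg_comp _ _ gb (@coord_continuous _ _ _ _ _ _)).
Qed.

Lemma cvg_enorm (T : Type) (F : set_system T) m (f : T -> 'rV[R]_m) a :
  Filter F -> f @ F --> a -> enorm (f x) @[x --> F] --> enorm a.
Proof.
move=> FF fa; apply: (cvg_comp (fun x => dot (f x) (f x)) Num.sqrt).
  exact: (cvg_dot FF fa fa).
exact: sqrt_continuous.
Qed.

Lemma is_derive_line (V W : normedModType R) (f : V -> W) u d (t : R) :
  differentiable f (u + t *: d) ->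
  is_derive t 1 (fun s => f (u + s *: d)) ('D_d f (u + t *: d)).
Proof.
move=> fd; apply: DeriveDef.
  apply/derivable1_diffP.
  have ld : differentiable (fun s : R => u + s *: d) t by [].
  exact: (differentiable_comp ld fd).
rewrite /derive; congr (lim _).
suff -> : (fun h : R => h^-1 *: (((fun s => f (u + s *: d)) \o shift t) (h *: 1) - f (u + t *: d))) =
  (fun h => h^-1 *: ((f \o shift (u + t *: d)) (h *: d) - f (u + t *: d))) by [].
apply/funext => h /=; congr (_ *: (f _ - _)).
by rewrite [h%:A]mulr1 scalerDl addrCA.
Qed.

(** Differentiability as an inequality, without the little-o calculus. *)
Lemma first_order_bound (V W : normedModType R) (f : V -> W) a e : 0 < e ->
  differentiable f a ->
  \forall w \near nbhs (0 : V), `|f (w + a) - f a - 'd f a w| <= e * `|w|.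
Proof.
move=> e0 /diff_locallyP[_ /eqaddoP/(_ _ e0)].
apply: filterS => w /=; rewrite /cst /=.
by rewrite opprD addrA.
Qed.

(** Mean value theorem for t |-> f (t s a + s b) - f (t s a), followed by the
    differentiability at 0 of the derivative [df] of [f] along [a].  The
    difference is symmetric in [a] and [b], so this limit yields the equality
    of mixed derivatives; and b = - a yields the second difference along [a]. *)
Lemma mixed_difference (V : normedModType R) (f df : V -> R) (a b : V) :
  (\forall u \near nbhs 0, is_derive u a f (df u)) ->
  (\forall u \near nbhs 0, differentiable f u) ->
  differentiable df 0 ->
  (f (s *: a + s *: b) - f (s *: a) - f (s *: b) + f 0) / s ^+ 2 @[s --> (0 : R)^']
    --> ('d df 0 b : R).
Proof.
move=> fd fdd dfd; apply/cvgrPdist_le => e e0.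
(* K |s| bounds the points of the parallelogram spanned by s a and s b; the
   summand 1 makes K positive. *)
pose K := `|a| + `|b| + 1; have K0 : 0 < K by rewrite ltr_wpDl// addr_ge0.
pose e' := e / (2 * K); have e'0 : 0 < e' by rewrite divr_gt0// mulr_gt0.
have := first_order_bound e'0 dfd.
move=> /(filterI fd)/(filterI fdd)/nbhs_norm0P[r /= r0 rP].
near=> s; have s0 : s != 0 by near: s; exact: nbhs_dnbhs_neq.
have sr (x y : R) : 0 <= x <= 1 -> 0 <= y <= 1 ->
    `|(x * s) *: a + (y * s) *: b| <= `|s| * (`|a| + `|b|).
  move=> /andP[x0 x1] /andP[y0 y1].
  rewrite (le_trans (ler_normD _ _))// !normrZ ?normrM (ger0_norm x0) (ger0_norm y0).
  rewrite mulrDr lerD// ler_wpM2r//.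
    by rewrite ler_piMl.
  by rewrite ler_piMl.
have sr' (x y : R) : 0 <= x <= 1 -> 0 <= y <= 1 ->
    `|(x * s) *: a + (y * s) *: b| < r.
  move=> x01 y01; apply: le_lt_trans (sr _ _ x01 y01) _.
  apply: (@le_lt_trans _ _ (`|s| * K)); first by rewrite ler_wpM2l// lerDl.
  rewrite -ltr_pdivlMr//.
  by near: s; apply: dnbhs0_lt; rewrite divr_gt0.
have z01 : 0 <= (0 : R) <= 1 by rewrite lexx ler01.
have o01 : 0 <= (1 : R) <= 1 by rewrite lexx ler01.
pose k (t : R) := f (s *: b + t *: (s *: a)) - f (0 + t *: (s *: a)).
pose dk (t : R) := s * df (s *: b + t *: (s *: a)) - s * df (0 + t *: (s *: a)).
have Pb (t : R) : 0 <= t <= 1 -> `|s *: b + t *: (s *: a)| < r.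
  by move=> t01; rewrite addrC scalerA -[s in X in _ + X]mul1r sr'.
have Pa (t : R) : 0 <= t <= 1 -> `|0 + t *: (s *: a)| < r.
  move=> t01; have := sr' t 0 t01 z01.
  by rewrite mul0r scale0r addr0 add0r scalerA.
have line c (t : R) : `|c + t *: (s *: a)| < r ->
    is_derive t (1:R) (fun t => f (c + t *: (s *: a))) (s * df (c + t *: (s *: a))).
  move=> /rP[fdt [fat _]]; apply: (is_derive_eq (is_derive_line fdt)).
  by rewrite deriveE// linearZ/= -deriveE// (derive_val (is_derive := fat)).
have kd (t : R) : t \in `[0, 1]%R -> is_derive t (1 : R) k (dk t).
  by rewrite in_itv/= => t01; apply: is_deriveB; apply: line; [exact: Pb|exact: Pa].
have kd' (t : R) : t \in `]0, 1[%R -> is_derive t (1 : R) k (dk t).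
  by move/subset_itv_oo_cc; exact: kd.
have kc : {within `[0, 1], continuous k}.
  by apply: derivable_within_continuous => x /kd [].
have [t t01 kt] := @MVT R k dk 0 1 ltr01 kd' kc.
have {}t01 : 0 <= t <= 1 by move: t01; rewrite in_itv/= => /andP[/ltW-> /ltW->].
have := (rP _ (Pb t t01)).2.2; have := (rP _ (Pa t t01)).2.2.
set wb := s *: b + _; set wa := 0 + _; rewrite !addr0 => Ha Hb.
have -> : (f (s *: a + s *: b) - f (s *: a) - f (s *: b) + f 0) = dk t.
  move: kt; rewrite subr0 mulr1 => <-.
  by rewrite /k !scale1r !scale0r !addr0 !add0r (addrC (s *: b)) opprB; ring.
have Lw : 'd df 0 wb - 'd df 0 wa = s * 'd df 0 b.
  by rewrite -linearB /wb /wa add0r addrK linearZ.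
have na : `|wa| <= `|s| * K.
  rewrite /wa add0r scalerA -[_ *: a]addr0 -(scale0r b) -(mul0r s).
  by rewrite (le_trans (sr _ _ t01 z01))// ler_wpM2l// lerDl.
have nb : `|wb| <= `|s| * K.
  rewrite /wb addrC scalerA -[s in X in _ + X]mul1r.
  by rewrite (le_trans (sr _ _ t01 o01))// ler_wpM2l// lerDl.
have -> : 'd df 0 b - dk t / s ^+ 2 =
    s^-1 * ((df wa - df 0 - 'd df 0 wa) - (df wb - df 0 - 'd df 0 wb)).
  have -> : (df wa - df 0 - 'd df 0 wa) - (df wb - df 0 - 'd df 0 wb) =
    ('d df 0 wb - 'd df 0 wa) - (df wb - df wa) by ring.
  rewrite Lw /dk -/wa -/wb; field.
  exact: s0.
rewrite normrM normfV ler_pdivrMl ?normr_gt0//.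
apply: le_trans (ler_normB _ _) _.
apply: le_trans (lerD Ha Hb) _.
rewrite -mulrDr; apply: (@le_trans _ _ (e' * (`|s| * K + `|s| * K))).
  by rewrite ler_wpM2l ?lerD// ltW.
rewrite le_eqVlt; apply/orP; left; apply/eqP; rewrite /e'; field.
by rewrite gt_eqF.
Unshelve. all: by end_near. Qed.

Lemma smooth_on_differentiable n (V : normedModType R) (U : set 'rV[R]_n)
  (f : 'rV[R]_n -> V) u : smooth_on U f -> U u -> differentiable f u.
Proof. by move=> fs Uu; exact: (fs [::]). Qed.

Lemma smooth_on_pd n (V : normedModType R) (U : set 'rV[R]_n)
  (f : 'rV[R]_n -> V) i : smooth_on U f -> smooth_on U (pd i f).
Proof. by move=> fs s u Uu; have := fs (rcons s i) u Uu; rewrite foldr_rcons. Qed.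

Lemma derive_sum_pd n (V : normedModType R) (f : 'rV[R]_n -> V) u v :
  differentiable f u -> 'D_v f u = \sum_i v 0 i *: pd i f u.
Proof.
move=> fd; rewrite deriveE// {1}[v]row_sum_delta linear_sum.
by apply: eq_bigr => i _; rewrite linearZ /pd deriveE.
Qed.

Lemma cvg_difference_quotient n m (f : 'rV[R]_n -> 'rV[R]_m) a (v : 'rV[R]_n) :
  differentiable f a ->
  s^-1 *: (f (a + s *: v) - f a) @[s --> (0 : R)^'] --> v *m jacobian f a.
Proof.
move=> fd; rewrite -deriveEjacobian//; have := @diff_derivable _ _ _ f a v fd.
rewrite /derivable /derive.
set g := (X in X @ _).
suff -> : (fun s => s^-1 *: (f (a + s *: v) - f a)) = g by [].
by apply/funext => s; rewrite /g /= [a + _]addrC.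
Qed.

(** Taken at 0, the point where the chart centred at a point of a hypersurface
    sees that point. *)
Definition hess n m (f : 'rV[R]_n -> 'rV[R]_m) (xi : 'rV[R]_m) : 'M[R]_n :=
  \matrix_(i, j) dot (pd j (pd i f) 0) xi.

Section Smooth.
Variables (n m : nat) (U : set 'rV[R]_n) (f : 'rV[R]_n -> 'rV[R]_m).
Hypotheses (Uo : open U) (U0 : U 0) (fs : smooth_on U f).

Lemma cvg_mixed_difference (xi : 'rV[R]_m) (a b : 'rV[R]_n) :
  dot (f (s *: a + s *: b) - f (s *: a) - f (s *: b) + f 0) xi / s ^+ 2
    @[s --> (0 : R)^'] --> dot (a *m hess f xi) b.
Proof.
pose g u := dot (f u) xi; pose dg u := \sum_i a 0 i * dot (pd i f u) xi.
have Un : \forall u \near nbhs (0 : 'rV[R]_n), U u by exact: open_nbhs_nbhs.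
have gd : \forall u \near nbhs (0 : 'rV[R]_n), is_derive u a g (dg u).
  apply: filterS Un => u Uu; have fd := smooth_on_differentiable fs Uu.
  have fD : is_derive u a f ('D_a f u) by apply/derivableP/diff_derivable.
  apply: (is_derive_eq (is_derive_dot fD (is_derive_cst xi u a))).
  rewrite dot0r addr0 derive_sum_pd// /dg.
  rewrite (big_morph (fun w => dot w xi) (fun u v => dotDl u v xi) (dot0l xi)).
  by apply: eq_bigr => i _; rewrite dotZl.
have gdd : \forall u \near nbhs (0 : 'rV[R]_n), differentiable g u.
  apply: filterS Un => u Uu; apply: differentiable_dotl.
  exact: smooth_on_differentiable fs Uu.
have pdd i : differentiable (pd i f) 0.
  exact: (smooth_on_differentiable (smooth_on_pd i fs) U0).
have dgE : dg = \sum_i (a 0 i \*: (fun u => dot (pd i f u) xi)).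
  by apply/funext => u; rewrite fct_sumE.
have dgd : differentiable dg 0.
  rewrite dgE; apply: differentiable_sum => i; apply: differentiableZ.
  exact: differentiable_dotl.
have -> : dot (a *m hess f xi) b = 'd dg 0 b.
  rewrite -deriveE//; have dD i : is_derive (0 : 'rV[R]_n) b
      (a 0 i \*: (fun u => dot (pd i f u) xi)) (a 0 i *: dot ('D_b (pd i f) 0) xi).
    have fD : is_derive (0 : 'rV[R]_n) b (pd i f) ('D_b (pd i f) 0).
      by apply/derivableP/diff_derivable.
    apply: is_deriveZ; apply: (is_derive_eq (is_derive_dot fD (is_derive_cst xi 0 b))).
    by rewrite dot0r addr0.
  rewrite dgE (derive_val (is_derive := is_derive_sum dD)).
  rewrite dot_mulmx dotE; apply: eq_bigr => i _; congr (_ * _).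
  rewrite derive_sum_pd// mxE.
  rewrite (big_morph (fun w => dot w xi) (fun u v => dotDl u v xi) (dot0l xi)).
  by apply: eq_bigr => j _; rewrite dotZl !mxE.
under eq_fun do rewrite dotDl !dotBl.
exact: mixed_difference gd gdd dgd.
Qed.

Lemma hess_sym xi : (hess f xi)^T = hess f xi.
Proof.
have H a b : dot (a *m hess f xi) b = dot (b *m hess f xi) a.
  pose F (a b : 'rV[R]_n) (s : R) :=
    dot (f (s *: a + s *: b) - f (s *: a) - f (s *: b) + f 0) xi / s ^+ 2.
  have Ea : F a b s @[s --> (0 : R)^'] --> dot (a *m hess f xi) b.
    exact: cvg_mixed_difference.
  have : F b a s @[s --> (0 : R)^'] --> dot (b *m hess f xi) a.
    exact: cvg_mixed_difference.
  have -> : F b a = F a b.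
    by apply/funext => s; rewrite /F (addrC (s *: b)) (addrAC _ (- f (s *: b))).
  exact: (cvg_unique (@Rhausdorff R) Ea).
apply/matrixP => i j; rewrite mxE.
have dd (u : 'rV[R]_n) k : dot u (delta_mx 0 k) = u 0 k.
  by rewrite /dot trmx_delta -colE mxE.
have := H (delta_mx 0 i) (delta_mx 0 j).
by rewrite !dd -!rowE [in LHS]mxE [in RHS]mxE.
Qed.

Lemma cvg_second_difference xi (v : 'rV[R]_n) :
  dot (f (s *: v) + f (- s *: v) - 2 *: f 0) xi / s ^+ 2
    @[s --> (0 : R)^'] --> dot (v *m hess f xi) v.
Proof.
pose F (s : R) :=
  dot (f (s *: v + s *: - v) - f (s *: v) - f (s *: - v) + f 0) xi / s ^+ 2.
have : - F s @[s --> (0 : R)^'] --> - dot (v *m hess f xi) (- v).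
  by apply: cvgN; exact: cvg_mixed_difference.
rewrite dotNr opprK.
have -> // : (fun s => - F s) =
  (fun s => dot (f (s *: v) + f (- s *: v) - 2 *: f 0) xi / s ^+ 2).
apply/funext => s; rewrite /F scalerN subrr -mulNr -dotNl; congr (dot _ _ / _).
by rewrite -scaleNr; apply/rowP => k; rewrite !mxE; ring.
Qed.

Lemma cvg_first_difference (v : 'rV[R]_n) :
  s^-1 *: (f (s *: v) - f 0) @[s --> (0 : R)^'] --> v *m jacobian f 0.
Proof.
have := @cvg_difference_quotient _ _ f 0 v (smooth_on_differentiable fs U0).
by under eq_fun do rewrite add0r.
Qed.

(** Mean value theorem, coordinate by coordinate, on the segment from [u] to
    [u']: its use is that the derivative at 0 controls differences between any
    two points near 0. *)
Lemma strict_differentiability e : 0 < e ->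
  exists2 r, 0 < r & (forall u, `|u| < r -> U u) /\
  forall u u' : 'rV[R]_n, `|u| < r -> `|u'| < r ->
    `|f u' - f u - (u' - u) *m jacobian f 0| <= e * `|u' - u|.
Proof.
move=> e0; pose e' := e / n.+1%:R; have e'0 : 0 < e' by rewrite divr_gt0.
have pdc i : \forall u \near nbhs (0 : 'rV[R]_n), `|pd i f 0 - pd i f u| <= e'.
  have : {for 0, continuous (pd i f)}.
    apply: differentiable_continuous.
    exact: (smooth_on_differentiable (smooth_on_pd i fs) U0).
  by move/cvgrPdist_le => /(_ _ e'0).
have cont : \forall u \near nbhs (0 : 'rV[R]_n), U u /\
    forall i, `|pd i f 0 - pd i f u| <= e'.
  apply: filterI; first exact: open_nbhs_nbhs.
  exact: (filter_forall _ pdc).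
have /nbhs_norm0P[r /= r0 rP] := cont; exists r => //; split => [u /rP[]//|].
move=> u u' ur u'r; set d := u' - u.
have seg t : 0 <= t <= 1 -> `|u + t *: d| < r.
  move=> /andP[t0 t1]; have -> : u + t *: d = (1 - t) *: u + t *: u'.
    by rewrite /d; apply/rowP => k; rewrite !mxE; ring.
  rewrite (le_lt_trans (ler_normD _ _))// !normrZ !ger0_norm ?subr_ge0//.
  have [->|t1'] := eqVneq t 1; first by rewrite subrr mul0r add0r mul1r.
  rewrite (@lt_le_trans _ _ ((1 - t) * r + t * r))//; last first.
    by rewrite -mulrDl subrK mul1r.
  apply: ltr_leD; last by apply: ler_wpM2l => //; exact: ltW.
  by rewrite ltr_pM2l// subr_gt0 lt_neqAle t1'.
rewrite [leLHS]/Num.norm/= mx_normrE; apply: bigmax_le.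
  by rewrite mulr_ge0// ltW.
move=> [i0 j] _ /=; rewrite ord1 {i0}.
pose g (t : R) := f (u + t *: d) 0 j - t * (d *m jacobian f 0) 0 j.
have gd (t : R) : t \in `[0, 1]%R ->
    is_derive t (1 : R) g (('D_d f (u + t *: d)) 0 j - (d *m jacobian f 0) 0 j).
  rewrite in_itv/= => /seg/rP[Ut _]; apply: is_deriveB.
    apply: is_derive_coord; apply: is_derive_line.
    exact: smooth_on_differentiable fs Ut.
  have := is_deriveM (is_derive_id t 1) (is_derive_cst ((d *m jacobian f 0) 0 j) t (1:R)).
  by rewrite scaler0 add0r [_ *: 1]mulr1; exact.
have gd' (t : R) : t \in `]0, 1[%R ->
    is_derive t (1 : R) g (('D_d f (u + t *: d)) 0 j - (d *m jacobian f 0) 0 j).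
  by move/subset_itv_oo_cc; exact: gd.
have gc : {within `[0, 1], continuous g}.
  by apply: derivable_within_continuous => x /gd [].
have [t t01 gt] := MVT ltr01 gd' gc.
have {}t01 : 0 <= t <= 1 by move: t01; rewrite in_itv/= => /andP[/ltW-> /ltW->].
have [Ut pdt] := rP _ (seg t t01).
have -> : (f u' - f u - d *m jacobian f 0) 0 j = g 1 - g 0.
  rewrite /g scale1r scale0r addr0 mul1r mul0r subr0 /d [u + _]addrC subrK.
  by rewrite !mxE; ring.
rewrite gt subr0 mulr1 -deriveEjacobian; last first.
  exact: smooth_on_differentiable fs U0.
rewrite !derive_sum_pd; try exact: smooth_on_differentiable fs _.
clear g gd gd' gc gt; clearbody d.
have sE (F : 'I_n -> 'rV[R]_m) :
    (\sum_i d 0 i *: F i) 0 j = \sum_i d 0 i * F i 0 j.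
  by rewrite summxE; apply: eq_bigr => i _; rewrite mxE.
rewrite !sE -sumrB; apply: le_trans (ler_norm_sum _ _ _) _.
apply: (@le_trans _ _ (\sum_(i < n) `|d| * e')).
  apply: ler_sum => i _; rewrite -mulrBr normrM.
  apply: ler_pM => //; first exact: normr_coord_le.
  apply: le_trans (pdt i); rewrite distrC.
  by apply: le_trans (normr_coord_le _ j); rewrite !mxE.
rewrite sumr_const card_ord -mulr_natl mulrCA mulrC ler_wpM2r//.
rewrite /e' mulrCA ger_pMr// ler_pdivrMr// mul1r ler_nat//.
Qed.

End Smooth.

End Calculus.

(** * Local geometry of a hypersurface *)

Section Hypersurface.
Variables (R : realType) (n : nat) (M : hypersurface R n).
Implicit Types p q : 'rV[R]_n.+1.

(** Near [p] the chart does not contract distances by more than a fixed factor,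
    because its derivative at 0 is injective, while its differences have
    arbitrarily small slope in the direction normal at [p]. *)
Lemma chart_strict_bounds p : carrier M p -> exists2 C, 0 < C &
  forall e, 0 < e -> exists2 r, 0 < r & (forall u, `|u| < r -> chart_dom M p u) /\
  forall u u' : 'rV[R]_n, `|u| < r -> `|u'| < r ->
    `|u' - u| <= C * enorm (chart M p u' - chart M p u) /\
    `|dot (chart M p u' - chart M p u) (unit_normal M p)| <= e * `|u' - u|.
Proof.
move=> Mp; have [Uo Us _ Tf _] := chart_patch Mp; have U0 := chart_dom0 Mp.
set T := jacobian (chart M p) 0.
have [T' TT'] : exists T', T *m T' = 1%:M by apply/row_freeP; exact: Tf.
have [K K0 KP] := enorm_mulmx_le T'.
exists (2 * K); first by rewrite mulr_gt0.
move=> e e0; pose N : R := n.+1%:R; have N0 : 0 < N by [].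
(* The first bound absorbs the error in the lower estimate on the chart, the
   second gives the slope; N compares the Euclidean norm with the sup norm. *)
pose e' := Num.min (2 * K * N)^-1 (e / N).
have e'0 : 0 < e' by rewrite lt_min invr_gt0 divr_gt0// andbT !mulr_gt0.
have e'K : e' * (2 * K * N) <= 1.
  by rewrite -ler_pdivlMr ?mulr_gt0// mul1r ge_min lexx.
have e'N : e' * N <= e by rewrite -ler_pdivlMr// ge_min lexx orbT.
have [r r0 [rU rP]] := strict_differentiability Uo U0 Us e'0.
exists r => //; split => // u u' ur u'r; have := rP u u' ur u'r.
set D := chart M p u' - chart M p u; set d := u' - u => err.
have {}err : enorm (D - d *m T) <= N * (e' * `|d|).
  by rewrite (le_trans (enorm_le_normr _))// ler_wpM2l ?(ltW N0).
split.
  have : `|d| <= K * (enorm D + N * (e' * `|d|)).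
    rewrite (le_trans (normr_le_enorm _))// -{1}[d]mulmx1 -TT' mulmxA.
    rewrite (le_trans (KP _))// ler_wpM2l ?(ltW K0)//.
    rewrite -[d *m T](subKr D); apply: le_trans (ler_enormD _ _) _.
    by rewrite enormN lerD.
  have := ler_wpM2r (normr_ge0 d) e'K; have := normr_ge0 d.
  by rewrite mul1r; nra.
rewrite -[D](subrK (d *m T)) dotDl normal_orth// addr0.
rewrite (le_trans (normr_dot_le _ _))// normal_unit// mulr1.
rewrite (le_trans err)// mulrA [N * _]mulrC ler_wpM2r//.
Qed.

Lemma chart_image_nbhs p r : carrier M p -> 0 < r ->
    (forall u, `|u| < r -> chart_dom M p u) ->
  exists2 V : set 'rV[R]_n.+1, open V /\ V p &
    chart M p @` [set u | `|u| < r] = carrier M `&` V.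
Proof.
move=> Mp r0 rU; have [_ _ _ _ /(_ [set u | `|u| < r])] := chart_patch Mp.
have -> : [set u : 'rV[R]_n | `|u| < r] = ball 0 r.
  by rewrite -ball_normE; apply/seteqP; split => u /=; rewrite sub0r normrN.
move=> [|u|V Vo VE]; first exact: ball_open.
  by rewrite -ball_normE /= sub0r normrN => /rU.
exists V => //; split => //.
have : (carrier M `&` V) p.
  by rewrite -VE; exists 0; [exact: ballxx|exact: chart0].
by case.
Qed.

Lemma chart_carrier p u : carrier M p -> chart_dom M p u ->
  carrier M (chart M p u).
Proof.
move=> Mp Uu; have [Uo _ _ _ /(_ _ Uo)[//|V _ VE]] := chart_patch Mp.
have : (carrier M `&` V) (chart M p u) by rewrite -VE; exists u.
by case.
Qed.

(** First-order contact of a hypersurface with its tangent plane, stated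
    without reference to a chart; this makes it possible to compare the chart
    centred at one point with the normal at another. *)
Lemma carrier_tangent_bound p e : carrier M p -> 0 < e ->
  \forall z \near p, carrier M z ->
    `|dot (z - p) (unit_normal M p)| <= e * enorm (z - p).
Proof.
move=> Mp e0; have [C C0 CP] := chart_strict_bounds Mp.
have [|r r0 [rU rP]] := CP (e / C); first by rewrite divr_gt0.
have [V [Vo Vp] VE] := chart_image_nbhs Mp r0 rU.
have : nbhs p V by exact: open_nbhs_nbhs.
apply: filterS => z Vz Mz.
have : (carrier M `&` V) z by split.
rewrite -VE => -[u /= ur <-{z Vz Mz}].
have [] := rP 0 u _ ur; rewrite ?normr0// chart0// subr0 => H1 H2.
rewrite (le_trans H2)// -mulrA ler_wpM2l ?(ltW e0)//.
by rewrite ler_pdivrMl.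
Qed.

Lemma velocity_orth (F : set_system R) (X : R -> 'rV[R]_n.+1) p w :
  ProperFilter F -> carrier M p -> (\forall s \near F, carrier M (X s)) ->
  X @ F --> p -> s^-1 *: (X s - p) @[s --> F] --> w ->
  dot w (unit_normal M p) = 0.
Proof.
move=> FF Mp MX Xp Xw; apply/eqP; rewrite -normr_le0; apply/ler_addgt0Pr => e e0.
rewrite add0r; pose k := enorm w + 1; have k0 : 0 < k.
  by rewrite ltr_wpDl// enorm_ge0.
have dw : `|dot (s^-1 *: (X s - p)) (unit_normal M p)| @[s --> F] -->
    `|dot w (unit_normal M p)|.
  by apply: cvg_norm; apply: cvg_dot => //; exact: cvg_cst.
have ek0 : 0 < e / k by rewrite divr_gt0.
have nw : e / k * enorm (s^-1 *: (X s - p)) @[s --> F] --> e / k * enorm w.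
  by apply: cvgMl_tmp; exact: cvg_enorm.
apply: (@le_trans _ _ (e / k * enorm w)); last first.
  by rewrite -mulrA ger_pMr// ler_pdivrMl// mulr1 lerDl.
apply: (ler_cvg_to dw nw).
have := Xp _ (carrier_tangent_bound Mp ek0).
rewrite !near_simpl; apply: filterS2 MX => s Ms /(_ Ms) H.
by rewrite dotZl enormZ normrM mulrCA ler_wpM2l.
Qed.

Lemma cvg_affine (V : normedModType R) (u v : V) :
  u + s *: v @[s --> (0 : R)^'] --> u.
Proof.
rewrite -{2}[u]addr0 -(scale0r v); apply: cvgD; first exact: cvg_cst.
by apply: cvgZr_tmp; exact: cvg_within.
Qed.

(** The definition of a hypersurface relates the normal at each point to the
    chart centred there only.  Away from the centre of a chart the
    orthogonality holds because coordinate lines are curves in the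
    hypersurface. *)
Lemma normal_orth_chart p u v : carrier M p -> chart_dom M p u ->
  dot (v *m jacobian (chart M p) u) (unit_normal M (chart M p u)) = 0.
Proof.
move=> Mp Uu; have [Uo Us _ _ _] := chart_patch Mp.
have ud := smooth_on_differentiable Us Uu.
have line := @cvg_affine _ u v.
apply: (velocity_orth (F := (0 : R)^') (X := fun s => chart M p (u + s *: v))).
- exact: chart_carrier.
- have : \forall s \near (0 : R)^', chart_dom M p (u + s *: v).
    by apply: line; exact: open_nbhs_nbhs.
  by apply: filterS => s; exact: chart_carrier.
- exact: (cvg_comp _ _ line (differentiable_continuous ud)).
- exact: cvg_difference_quotient.
Qed.

Definition second_form p : 'M[R]_n := hess (chart M p) (unit_normal M p).

Let normal_map p := unit_normal M \o chart M p.

Lemma jacobian_row m (f : 'rV[R]_n -> 'rV[R]_m) u i :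
  differentiable f u -> row i (jacobian f u) = pd i f u.
Proof. by move=> fd; rewrite rowE -deriveEjacobian. Qed.

(** Weingarten equation: differentiate the relation that the coordinate vectors
    are orthogonal to the normal along the whole chart. *)
Lemma second_form_normal_map p : carrier M p ->
  second_form p = - (tangent_frame M p *m (jacobian (normal_map p) 0)^T).
Proof.
move=> Mp; have [Uo Us _ _ _] := chart_patch Mp; have U0 := chart_dom0 Mp.
have Ns := normal_smooth Mp.
have fd := smooth_on_differentiable Us U0.
have Nd := smooth_on_differentiable Ns U0.
apply/matrixP => i j; rewrite !mxE.
have -> : \sum_k tangent_frame M p i k * (jacobian (normal_map p) 0)^T k j =
    dot (pd i (chart M p) 0) (pd j (normal_map p) 0).
  rewrite -(jacobian_row i fd) -(jacobian_row j Nd) dotE /tangent_frame.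
  move: (jacobian (chart M p) 0) (jacobian (normal_map p) 0) => A B.
  by apply: eq_bigr => k _; rewrite !mxE.
pose g u := dot (pd i (chart M p) u) (normal_map p u).
have g0 : \forall u \near (0 : 'rV[R]_n), 0 = g u.
  have : nbhs (0 : 'rV[R]_n) (chart_dom M p) by exact: open_nbhs_nbhs.
  apply: filterS => u Uu; have ud := smooth_on_differentiable Us Uu.
  by rewrite /g -(jacobian_row i ud) rowE normal_orth_chart.
have pdD (f : 'rV[R]_n -> 'rV[R]_n.+1) : differentiable f 0 ->
    is_derive (0 : 'rV[R]_n) (delta_mx 0 j : 'rV[R]_n) f (pd j f 0).
  by move=> ?; apply/derivableP/diff_derivable.
have D1 := near_eq_is_derive g0 (is_derive_cst (0:R) (0 : 'rV[R]_n) (delta_mx 0 j : 'rV[R]_n)).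
have D2 := is_derive_dot
  (pdD _ (smooth_on_differentiable (smooth_on_pd i Us) U0)) (pdD _ Nd).
have := derive_val (is_derive := D2); rewrite (derive_val (is_derive := D1)).
by move/esym/eqP; rewrite addr_eq0 => /eqP; rewrite /normal_map /= chart0.
Qed.

Lemma jacobian_normal_orth p : carrier M p ->
  jacobian (normal_map p) 0 *m (unit_normal M p)^T = 0.
Proof.
move=> Mp; have [Uo Us _ _ _] := chart_patch Mp; have U0 := chart_dom0 Mp.
have Nd := smooth_on_differentiable (normal_smooth Mp) U0.
apply: dot_row0 => v; rewrite -deriveEjacobian//.
pose g u := dot (normal_map p u) (normal_map p u).
have g1 : \forall u \near (0 : 'rV[R]_n), 1 = g u.
  have : nbhs (0 : 'rV[R]_n) (chart_dom M p) by exact: open_nbhs_nbhs.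
  apply: filterS => u Uu; rewrite /g -enorm_sqr normal_unit ?expr1n//.
  exact: chart_carrier.
have D1 := near_eq_is_derive g1 (is_derive_cst (1:R) (0 : 'rV[R]_n) v).
have ND : is_derive (0 : 'rV[R]_n) v (normal_map p) ('D_v (normal_map p) 0).
  by apply/derivableP/diff_derivable.
have := derive_val (is_derive := is_derive_dot ND ND).
rewrite (derive_val (is_derive := D1)) (dotC (normal_map p 0)).
rewrite {2 4}/normal_map /= chart0// => /esym/eqP.
by rewrite -mulr2n mulrn_eq0 /= => /eqP.
Qed.

Lemma tangent_frame_free p : carrier M p -> row_free (tangent_frame M p).
Proof. by move=> Mp; have [_ _ _ + _] := chart_patch Mp; apply; exact: chart_dom0. Qed.

Lemma tangent_frame_normal p : carrier M p ->
  tangent_frame M p *m (unit_normal M p)^T = 0.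
Proof. by move=> Mp; apply: dot_row0 => v; exact: normal_orth. Qed.

Lemma normal_dot p : carrier M p -> dot (unit_normal M p) (unit_normal M p) = 1.
Proof. by move=> Mp; rewrite -enorm_sqr normal_unit// expr1n. Qed.

Lemma second_form_sym p : carrier M p -> (second_form p)^T = second_form p.
Proof.
by move=> Mp; have [Uo Us _ _ _] := chart_patch Mp; apply: hess_sym Uo _ Us _;
  exact: chart_dom0.
Qed.

(** The derivative of the unit normal is tangential, so the pseudo-inverse in
    the definition of the shape operator is a true inverse on it. *)
Lemma shape_mx_frame p : carrier M p ->
  shape_mx M p *m tangent_frame M p = - jacobian (normal_map p) 0.
Proof.
move=> Mp; have Tf := tangent_frame_free Mp.
rewrite /shape_mx mulmxKpV// eqmx_opp -[jacobian _ _]mulmx1.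
set T := tangent_frame M p.
have := tangent_normal_resolution Tf (tangent_frame_normal Mp) (normal_dot Mp).
move/(congr1 (mulmx (jacobian (normal_map p) 0))).
rewrite mulmxBr (mulmxA _ (unit_normal M p)^T) jacobian_normal_orth// mul0mx subr0.
by move=> <-; rewrite !mulmxA submxMl.
Qed.

Lemma shape_mxE p : carrier M p ->
  shape_mx M p =
  second_form p *m invmx (tangent_frame M p *m (tangent_frame M p)^T).
Proof.
move=> Mp; have Gu := gram_unit (tangent_frame_free Mp).
rewrite -[LHS](mulmxK Gu); congr (_ *m _).
rewrite mulmxA shape_mx_frame// -second_form_sym// second_form_normal_map//.
by rewrite linearN /= trmx_mul trmxK mulNmx.
Qed.

(** The shape operator is the second fundamental form divided by the metric,
    so it has a split characteristic polynomial and its trace is the sum of the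
    principal curvatures. *)
Lemma second_form_trace p : carrier M p -> (0 < n)%N ->
  \tr (second_form p *m invmx (tangent_frame M p *m (tangent_frame M p)^T)) =
  n%:R * mean_curvature M p.
Proof.
move=> Mp n0; rewrite -shape_mxE//; rewrite /mean_curvature mulrC divfK ?pnatr_eq0 -?lt0n//.
apply: trace_split; rewrite /principal_curvatures; set P := (X in xget _ X).
suff : P (xget [::] P) by [].
apply: xgetPex; have [s [sE _]] := symmetric_pencil_split (second_form_sym Mp)
  (gram_sym _) (fun v => gram_pos (tangent_frame_free Mp)).
by exists s; rewrite /P /= shape_mxE.
Qed.

Lemma second_form_le_shape_norm p (r : 'rV[R]_n) : carrier M p ->
  `|dot (r *m second_form p) r| <=
    shape_norm M p * enorm (r *m tangent_frame M p) ^+ 2.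
Proof.
move=> Mp; have Tf := tangent_frame_free Mp; set T := tangent_frame M p.
set S := shape_mx M p.
have -> : dot (r *m second_form p) r = dot (r *m S *m T) (r *m T).
  have -> : second_form p = S *m (T *m T^T) by rewrite /S shape_mxE// mulmxKV ?gram_unit.
  by rewrite /dot trmx_mul !mulmxA.
have [->|r0] := eqVneq r 0; first by rewrite !mul0mx dot0l enorm0 normr0 expr0n mulr0.
have rT : 0 < enorm (r *m T) by rewrite enorm_gt0// row_free_mul_eq0.
rewrite (le_trans (normr_dot_le _ _))// expr2 mulrA ler_wpM2r ?enorm_ge0//.
rewrite -ler_pdivrMr//; apply: ub_le_sup.
  have [T' TT'] : exists T', T *m T' = 1%:M by apply/row_freeP.
  have [K K0 KP] := enorm_mulmx_le (T' *m S *m T).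
  exists K => _ [v /= v1 <-]; have := KP (v *m T).
  by rewrite v1 mulr1 !mulmxA -(mulmxA v) TT' mulmx1.
exists ((enorm (r *m T))^-1 *: r) => /=.
  by rewrite -scalemxAl enormZ ger0_norm ?invr_ge0 ?enorm_ge0// mulVf// gt_eqF.
by rewrite -!scalemxAl enormZ ger0_norm ?invr_ge0 ?enorm_ge0// mulrC.
Qed.

End Hypersurface.

(** * Variation of a penalised distance *)

Section Variation.
Variables (R : realType) (n : nat).
Implicit Types M : hypersurface R n.

(** The quadratic term is negligible along a curve through [p], and both
    directions of the curve are admissible. *)
Lemma first_order_condition M p (mu : 'rV[R]_n.+1) (K : R) :
  carrier M p ->
  (forall q, carrier M q -> 0 <= dot (q - p) mu + K * dot (q - p) (q - p)) ->
  forall v : 'rV[R]_n, dot (v *m tangent_frame M p) mu = 0.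
Proof.
move=> Mp H; have [Uo Us _ _ _] := chart_patch Mp; have U0 := chart_dom0 Mp.
suff ge0 v : 0 <= dot (v *m tangent_frame M p) mu.
  move=> v; apply/eqP; rewrite eq_le ge0 andbT.
  by have := ge0 (- v); rewrite mulNmx dotNl oppr_ge0.
pose D (s : R) := s^-1 *: (chart M p (s *: v) - p).
have Dl : D s @[s --> (0 : R)^'+] --> v *m tangent_frame M p.
  have := @cvg_first_difference _ _ _ _ _ U0 Us v; rewrite (chart0 Mp).
  exact: cvg_dnbhs_at_right.
have sl : s @[s --> (0 : R)^'+] --> (0 : R).
  by apply: cvg_dnbhs_at_right; exact: cvg_within.
have El : dot (D s) mu + s * (K * dot (D s) (D s)) @[s --> (0 : R)^'+] -->
    dot (v *m tangent_frame M p) mu + 0 * (K * dot (v *m tangent_frame M p)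
      (v *m tangent_frame M p)).
  apply: cvgD; first by apply: cvg_dot => //; exact: cvg_cst.
  by apply: cvgM => //; apply: cvgMl_tmp; exact: cvg_dot.
rewrite mul0r addr0 in El.
apply: (ler_cvg_to (cvg_cst (0 : R)) El).
have Us' : \forall s \near (0 : R)^'+, chart_dom M p (s *: v).
  have := @cvg_affine _ _ (0 : 'rV[R]_n) v; under eq_fun do rewrite add0r.
  move=> /(@cvg_dnbhs_at_right _ _ _ _ _); apply; exact: open_nbhs_nbhs.
near=> s; have s0 : 0 < s by near: s; exact: nbhs_right_gt.
have sU : chart_dom M p (s *: v) by near: s.
have := H _ (chart_carrier Mp sU).
have -> : chart M p (s *: v) - p = s *: D s.
  by rewrite /D scalerA mulfV ?scale1r// gt_eqF.
rewrite dotZl [dot (s *: D s) _]dotZl dotZr.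
set a := dot _ mu; set b := dot _ (D s).
have -> : s * a + K * (s * (s * b)) = s * (a + s * (K * b)) by ring.
by rewrite pmulr_rge0.
Unshelve. all: by end_near. Qed.

Lemma normal_multiple M p (mu : 'rV[R]_n.+1) : carrier M p ->
  (forall v : 'rV[R]_n, dot (v *m tangent_frame M p) mu = 0) ->
  mu = dot mu (unit_normal M p) *: unit_normal M p.
Proof.
move=> Mp /dot_row0 Tm.
have := tangent_normal_resolution (tangent_frame_free Mp)
  (tangent_frame_normal Mp) (normal_dot Mp).
move/(congr1 (mulmx mu)); rewrite mulmxBr mulmx1 !mulmxA.
rewrite -[mu *m _^T]trmxK trmx_mul trmxK Tm trmx0 !mul0mx => /esym/eqP.
rewrite subr_eq0 => /eqP {1}->; set N := unit_normal M p.
by rewrite [mu *m _]mx11_scalar mul_scalar_mx.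
Qed.

Lemma nearest_point_normal M p z : carrier M p ->
  (forall q, carrier M q -> enorm (z - p) <= enorm (z - q)) ->
  z - p = dot (z - p) (unit_normal M p) *: unit_normal M p.
Proof.
move=> Mp zp; apply: normal_multiple => // v; apply/eqP; rewrite -oppr_eq0 -dotNr.
apply/eqP; apply: (@first_order_condition M p _ 2^-1 Mp) => q Mq.
have := zp q Mq; rewrite -ler_sqr ?nnegrE ?enorm_ge0// !enorm_sqr.
have -> : z - q = (z - p) - (q - p) by apply/rowP => i; rewrite !mxE; ring.
move: (z - p) (q - p) => a b; rewrite !dotBl !dotBr dotNr (dotC b a); lra.
Qed.

(** Writing a for the component of z along [nu] and b for the orthogonal one,
    sqrt (a^2 + b^2) <= a + b^2 / (2 a), and 2 a >= d.  The bound is sharp to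
    second order when b = 0, unlike the simpler (|z|^2 + d^2) / (2 d). *)
Lemma enorm_le_affine m (z nu : 'rV[R]_m) (d : R) : dot nu nu = 1 -> 0 < d ->
  d / 2 <= dot z nu ->
  enorm z <= dot z nu + (dot z z - dot z nu ^+ 2) / d.
Proof.
move=> nu1 d0 da; set a := dot z nu.
have a0 : 0 < a by rewrite (lt_le_trans _ da)// divr_gt0.
have en1 : enorm nu = 1 by rewrite /enorm nu1 sqrtr1.
have az : a <= enorm z by have := dot_le_enorm z nu; rewrite en1 mulr1.
rewrite -lerBlDl ler_pdivlMr//.
rewrite -enorm_sqr subr_sqr ler_wpM2l ?subr_ge0//.
by move: da az; rewrite ler_pdivrMr// -/a; lra.
Qed.

(** The penalty function: it tends to infinity, and its derivatives of first
    and second order are bounded. *)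
Definition rho m (x : 'rV[R]_m) := Num.sqrt (1 + dot x x).

Lemma rho_sqr m (x : 'rV[R]_m) : rho x ^+ 2 = 1 + dot x x.
Proof. by rewrite sqr_sqrtr// addr_ge0// dot_ge0. Qed.

Lemma rho_ge1 m (x : 'rV[R]_m) : 1 <= rho x.
Proof. by rewrite -ler_sqr ?nnegrE ?sqrtr_ge0// rho_sqr expr1n lerDl dot_ge0. Qed.

(** The concave function sqrt lies below its tangent at 1 + |x|^2. *)
Lemma rho_le_quadratic m (x x' : 'rV[R]_m) :
  rho x' - rho x <= (2 * rho x)^-1 * (2 * dot (x' - x) x + dot (x' - x) (x' - x)).
Proof.
have := rho_ge1 x; have := rho_ge1 x'; have := rho_sqr x; have := rho_sqr x'.
move=> e' e r' r; rewrite ler_pdivlMl ?mulr_gt0// ?(lt_le_trans ltr01)//.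
rewrite !dotBl !dotBr (dotC x x').
have : 0 <= (rho x' - rho x) ^+ 2 by rewrite sqr_ge0.
by rewrite sqrrB; nra.
Qed.

Section SecondVariation.
Variables (M1 M2 : hypersurface R n) (x y nu : 'rV[R]_n.+1) (d eps k : R).
Hypotheses (M2x : carrier M2 x) (M1y : carrier M1 y).
Hypotheses (d0 : 0 < d) (nu1 : dot nu nu = 1) (nuE : x - y = d *: nu).
Hypotheses (k0 : 0 < k) (kE : eps = k * rho x).
Hypothesis xy_min : forall x' y', carrier M2 x' -> carrier M1 y' ->
  enorm (x - y) + eps * rho x <= enorm (x' - y') + eps * rho x'.

(** An upper bound for the change of |x - y| + eps * rho (x) when x and y are
    displaced by [X] and [Y]: the square roots are replaced by the polynomial
    bounds of [enorm_le_affine] and [rho_le_quadratic], so that second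
    differences can be taken term by term. *)
Definition pair_excess (X Y : 'rV[R]_n.+1) : R :=
  dot X (nu + k *: x) - dot Y nu + (dot (X - Y) (X - Y) - dot (X - Y) nu ^+ 2) / d
  + k / 2 * dot X X.

Lemma pair_excess_ge0 x' y' : carrier M2 x' -> carrier M1 y' ->
  d / 2 <= dot (x' - y') nu -> 0 <= pair_excess (x' - x) (y' - y).
Proof.
move=> Mx' My' H; have := xy_min Mx' My'; have := enorm_le_affine nu1 d0 H.
have := rho_le_quadratic x x'.
have -> : enorm (x - y) = d.
  by rewrite nuE enormZ /enorm nu1 sqrtr1 mulr1 gtr0_norm.
rewrite /pair_excess.
set X := x' - x; set Y := y' - y.
have -> : x' - y' = X - Y + d *: nu.
  by rewrite -nuE; apply/rowP => i; rewrite !mxE; ring.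
clearbody X Y; rewrite dotDr dotZr; move: (X - Y) (dotBl X Y nu) => Z ZE.
rewrite !dotDl !dotDr !dotZl !dotZr nu1 (dotC nu).
have := rho_ge1 x; set r := rho x; set r' := rho x' => r1.
have r0 : 0 < r by exact: lt_le_trans r1.
move=> H1 H2 H3; have eps0 : 0 < eps by rewrite kE mulr_gt0.
have {}H1 : eps * (r' - r) <= k / 2 * (2 * dot X x + dot X X).
  have -> : k / 2 * (2 * dot X x + dot X X) =
      eps * ((2 * r)^-1 * (2 * dot X x + dot X X)).
    by rewrite kE -/r; field; rewrite gt_eqF.
  by rewrite ler_wpM2l// ltW.
set a := dot Z nu in ZE H2 *; set b := dot Z Z in H2 *.
have E : (b + d * a + d * (a + d * 1) - (a + d * 1) ^+ 2) / d =
  (b - a ^+ 2) / d by field; rewrite gt_eqF.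
move: H2; rewrite E mulr1 => H2.
lra.
Qed.

Lemma pair_excess_sum_scaled (s : R) (X X' Y Y' : 'rV[R]_n.+1) : s != 0 ->
  let E (Z : 'rV[R]_n.+1) := dot Z Z - dot Z nu ^+ 2 in
  (pair_excess X Y + pair_excess X' Y') / s ^+ 2 =
    dot (X + X') (nu + k *: x) / s ^+ 2 - dot (Y + Y') nu / s ^+ 2
    + (E (s^-1 *: X - s^-1 *: Y) + E (s^-1 *: X' - s^-1 *: Y')) / d
    + k / 2 * (dot (s^-1 *: X) (s^-1 *: X) + dot (s^-1 *: X') (s^-1 *: X')).
Proof.
move=> s0 E; rewrite /E -!scalerBr !dotZl !dotZr /pair_excess !(dotDl _ _ nu) (dotDl X X').
move: (dot X (nu + _)) (dot X' (nu + _)) => a1 a2; move: (dot Y nu) (dot Y' nu) => b1 b2.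
move: (X - Y) (X' - Y') => Z Z'.
field; by rewrite s0 gt_eqF.
Qed.

(** Take the second difference of [pair_excess] along the coordinate lines of
    directions [v] and [w].  The velocity of x - y is a multiple of [nu], on
    which the form z |-> |z|^2 - <z, nu>^2 divided by [d] vanishes. *)
Lemma second_variation (v w : 'rV[R]_n) :
  w *m tangent_frame M1 y = v *m tangent_frame M2 x -
    dot (v *m tangent_frame M2 x) nu *: nu ->
  dot (w *m hess (chart M1 y) nu) w <=
    dot (v *m hess (chart M2 x) (nu + k *: x)) v +
    k * dot (v *m tangent_frame M2 x) (v *m tangent_frame M2 x).
Proof.
move=> wv; set a := v *m tangent_frame M2 x in wv *.
set b := w *m tangent_frame M1 y in wv *.
have [U1o U1s _ _ _] := chart_patch M1y; have U10 := chart_dom0 M1y.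
have [U2o U2s _ _ _] := chart_patch M2x; have U20 := chart_dom0 M2x.
pose X (u : 'rV[R]_n) (s : R) := chart M2 x (s *: u) - x.
pose Y (u : 'rV[R]_n) (s : R) := chart M1 y (s *: u) - y.
have Xl u : s^-1 *: X u s @[s --> (0 : R)^'] --> u *m tangent_frame M2 x.
  by have := @cvg_first_difference _ _ _ _ _ U20 U2s u; rewrite (chart0 M2x).
have Yl u : s^-1 *: Y u s @[s --> (0 : R)^'] --> u *m tangent_frame M1 y.
  by have := @cvg_first_difference _ _ _ _ _ U10 U1s u; rewrite (chart0 M1y).
have X2 : dot (X v s + X (- v) s) (nu + k *: x) / s ^+ 2 @[s --> (0 : R)^'] -->
    dot (v *m hess (chart M2 x) (nu + k *: x)) v.
  have := @cvg_second_difference _ _ _ _ _ U2o U20 U2s (nu + k *: x) v.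
  have -> // : (fun s : R => dot (X v s + X (- v) s) (nu + k *: x) / s ^+ 2) =
    (fun s => dot (chart M2 x (s *: v) + chart M2 x (- s *: v) - 2 *: chart M2 x 0)
       (nu + k *: x) / s ^+ 2).
  apply/funext => s; congr (dot _ _ / _); rewrite /X (chart0 M2x) scalerN scaleNr.
  by apply/rowP => i; rewrite !mxE; ring.
have Y2 : dot (Y w s + Y (- w) s) nu / s ^+ 2 @[s --> (0 : R)^'] -->
    dot (w *m hess (chart M1 y) nu) w.
  have := @cvg_second_difference _ _ _ _ _ U1o U10 U1s nu w.
  have -> // : (fun s : R => dot (Y w s + Y (- w) s) nu / s ^+ 2) =
    (fun s => dot (chart M1 y (s *: w) + chart M1 y (- s *: w) - 2 *: chart M1 y 0)
       nu / s ^+ 2).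
  apply/funext => s; congr (dot _ _ / _); rewrite /Y (chart0 M1y) scalerN scaleNr.
  by apply/rowP => i; rewrite !mxE; ring.
pose E (Z : 'rV[R]_n.+1) := dot Z Z - dot Z nu ^+ 2.
have El (Z : R -> 'rV[R]_n.+1) z : Z s @[s --> (0 : R)^'] --> z ->
    E (Z s) @[s --> (0 : R)^'] --> E z.
  move=> Zz; apply: cvgB; first exact: cvg_dot.
  rewrite expr2; under eq_fun do rewrite expr2.
  by apply: cvgM; apply: cvg_dot => //; exact: cvg_cst.
(* This is where the choice of w matters: a - b is a multiple of nu. *)
have E0 : E (a - b) = 0.
  rewrite wv opprB addrCA subrr addr0 /E !dotZl !dotZr nu1 !mulr1 expr2 subrr.
  by [].
have E0' : E (- (a - b)) = 0 by rewrite /E !dotNl dotNr opprK sqrrN.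
have lim : dot (X v s + X (- v) s) (nu + k *: x) / s ^+ 2
    - dot (Y w s + Y (- w) s) nu / s ^+ 2
    + (E (s^-1 *: X v s - s^-1 *: Y w s) +
       E (s^-1 *: X (- v) s - s^-1 *: Y (- w) s)) / d
    + k / 2 * (dot (s^-1 *: X v s) (s^-1 *: X v s) +
         dot (s^-1 *: X (- v) s) (s^-1 *: X (- v) s))
    @[s --> (0 : R)^'] -->
    dot (v *m hess (chart M2 x) (nu + k *: x)) v - dot (w *m hess (chart M1 y) nu) w
    + (E (a - b) + E (- (a - b))) / d + k / 2 * (dot a a + dot (- a) (- a)).
  apply: cvgD; last first.
    apply: cvgMl_tmp; apply: cvgD; first by apply: cvg_dot; exact: Xl.
    by rewrite -mulNmx; apply: cvg_dot; exact: Xl.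
  apply: cvgD; first exact: cvgB.
  apply: cvgMr_tmp; apply: cvgD; apply: El.
    by apply: cvgB; [exact: Xl|exact: Yl].
  have -> : - (a - b) = - v *m tangent_frame M2 x - (- w *m tangent_frame M1 y).
    by rewrite !mulNmx opprB opprK addrC.
  by apply: cvgB; [exact: Xl|exact: Yl].
have {lim} : 0 <= dot (v *m hess (chart M2 x) (nu + k *: x)) v -
    dot (w *m hess (chart M1 y) nu) w
    + (E (a - b) + E (- (a - b))) / d + k / 2 * (dot a a + dot (- a) (- a)).
  apply: (ler_cvg_to (cvg_cst (0 : R)) lim).
  have good u u' : \forall s \near (0 : R)^',
      0 <= pair_excess (X u s) (Y u' s).
    have l2 := @cvg_affine _ _ (0 : 'rV[R]_n) u.
    have l1 := @cvg_affine _ _ (0 : 'rV[R]_n) u'.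
    have n2 : \forall s \near (0 : R)^', chart_dom M2 x (0 + s *: u).
      by apply: l2; exact: open_nbhs_nbhs.
    have n1 : \forall s \near (0 : R)^', chart_dom M1 y (0 + s *: u').
      by apply: l1; exact: open_nbhs_nbhs.
    have c2 := cvg_comp _ _ l2
      (differentiable_continuous (smooth_on_differentiable U2s U20)).
    have c1 := cvg_comp _ _ l1
      (differentiable_continuous (smooth_on_differentiable U1s U10)).
    have zl : dot (chart M2 x (0 + s *: u) - chart M1 y (0 + s *: u')) nu
        @[s --> (0 : R)^'] --> dot (chart M2 x 0 - chart M1 y 0) nu.
      apply: cvg_dot; last exact: cvg_cst.
      by apply: cvgB; [exact: c2|exact: c1].
    have n3 : \forall s \near (0 : R)^',
        d / 2 <= dot (chart M2 x (0 + s *: u) - chart M1 y (0 + s *: u')) nu.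
      apply: (cvgr_ge _ zl); rewrite (chart0 M2x) (chart0 M1y) nuE dotZl nu1 mulr1.
      by rewrite ltr_pdivrMr// ltr_pMr// ltr1n.
    near=> s; rewrite /X /Y; apply: pair_excess_ge0.
    - by apply: chart_carrier => //; rewrite -[s *: u]add0r; near: s.
    - by apply: chart_carrier => //; rewrite -[s *: u']add0r; near: s.
    - by rewrite -[s *: u]add0r -[s *: u']add0r; near: s.
  near=> s; rewrite /E -pair_excess_sum_scaled.
    by rewrite divr_ge0 ?sqr_ge0// addr_ge0//; near: s; exact: good.
  by near: s; exact: nbhs_dnbhs_neq.
rewrite E0 E0' addr0 mul0r addr0 dotNl dotNr opprK; lra.
Unshelve. all: by end_near. Qed.

End SecondVariation.

End Variation.

(** * Minimisation over a proper hypersurface *)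

Section Minima.
Variables (R : realType) (n : nat) (M : hypersurface R n).

(** Sublevel sets of [f] on a properly embedded hypersurface are compact. *)
Lemma carrier_min (f : 'rV[R]_n.+1 -> R) : continuous f ->
  (forall B, exists K, forall x, carrier M x -> f x <= B -> enorm x <= K) ->
  exists2 x, carrier M x & forall x', carrier M x' -> f x <= f x'.
Proof.
move=> fc fcoer; have [x0 Mx0] := carrier_neq0 M.
have [K0 KP] := fcoer (f x0); pose K := Num.max K0 1 + 1.
have K_gt0 : 0 < K by rewrite ltr_pwDr// le_max ler01 orbT.
pose A : set 'rV[R]_n.+1 := closed_ball 0 K.
have AE x : A x <-> `|x| <= K.
  by rewrite /A closed_ballE// /closed_ball_ /= sub0r normrN.
have Ac : compact A.
  apply: bounded_closed_compact; last exact: closed_ball_closed.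
  by exists K; split; [exact: num_real|] => B KB x /AE xK; apply: le_trans xK (ltW KB).
have MAx x : carrier M x -> f x <= f x0 -> (carrier M `&` A) x.
  move=> Mx fx; split => //; apply/AE; rewrite (le_trans (normr_le_enorm _))//.
  by rewrite (le_trans (KP _ Mx fx))// ler_wpDr// le_max lexx.
have [||x] := @EVT_min_rV R n.+1 f (carrier M `&` A) _ (carrier_proper Ac).
- by exists x0; exact: MAx.
- exact: continuous_subspaceT.
rewrite inE => -[Mx _] xP; exists x => // x' Mx'.
have [fx'|/ltW fx'] := leP (f x') (f x0).
  by apply: xP; rewrite inE; exact: MAx.
by apply: le_trans fx'; apply: xP; rewrite inE; exact: MAx.
Qed.

Lemma continuous_enorm m (z : 'rV[R]_m) : continuous (fun x : 'rV[R]_m => enorm (z - x)).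
Proof.
move=> x; apply: (@cvg_enorm _ _ (nbhs x) _ (fun y => z - y)).
by apply: cvgB; [exact: cvg_cst|exact: cvg_id].
Qed.

Lemma exists_nearest z :
  exists2 q, carrier M q & forall q', carrier M q' -> enorm (z - q) <= enorm (z - q').
Proof.
apply: carrier_min; first exact: continuous_enorm.
move=> B; exists (enorm z + B) => x _ zx.
have -> : x = z + - (z - x) by rewrite opprB addrC subrK.
by rewrite (le_trans (ler_enormD _ _))// enormN lerD.
Qed.

End Minima.

(** * The two sides of a hypersurface *)

Section Sides.
Variables (R : realType).

Lemma path_connected_component (V : normedModType R) (A : set V) (g : R -> V) :
  {in `[0, 1]%R, continuous g} -> (forall t : R, 0 <= t <= 1 -> A (g t)) ->
  connected_component A (g 0) (g 1).
Proof.
move=> gc gA; apply: (@connected_component_max _ A (g @` `[0, 1])).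
- by exists 0 => //=; rewrite in_itv/= lexx ler01.
- by move=> _ [t /= t01 <-]; apply: gA; rewrite in_itv/= in t01.
- apply: connected_continuous_connected; first exact: segment_connected.
  by apply: continuous_in_subspaceT => t /[!inE] /= t01; exact: gc.
- by exists 1 => //=; rewrite in_itv/= lexx ler01.
Qed.

Variables (n : nat) (M : hypersurface R n).

(** A point of the open segment is strictly closer to [z] than [q] is, hence
    lies outside of the hypersurface. *)
Lemma nearest_segment_component z q : carrier M q ->
  (forall q', carrier M q' -> enorm (z - q) <= enorm (z - q')) ->
  ~ carrier M z -> forall t, 0 < t <= 1 ->
  connected_component (~` carrier M) z (q + t *: (z - q)).
Proof.
move=> Mq qP Mz t /andP[t0 t1].
have zq0 : z - q != 0 by rewrite subr_eq0; apply/eqP => zq; apply: Mz; rewrite zq.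
pose g (s : R) := z + s *: ((t - 1) *: (z - q)).
have g0 : g 0 = z by rewrite /g scale0r addr0.
have g1 : g 1 = q + t *: (z - q).
  by rewrite /g scale1r; apply/rowP => i; rewrite !mxE; ring.
rewrite -g1 -[X in connected_component _ X]g0; apply: path_connected_component.
  move=> s _; apply: cvgD; first exact: cvg_cst.
  by apply: cvgZr_tmp; exact: cvg_id.
move=> s /andP[s0 s1] /= /qP.
have -> : z - g s = (s * (1 - t)) *: (z - q).
  by rewrite /g; apply/rowP => i; rewrite !mxE; ring.
rewrite enormZ ger0_norm ?mulr_ge0 ?subr_ge0// -ler_pdivrMr ?enorm_gt0//.
rewrite divff ?enorm_eq0// => H.
have : s * (1 - t) <= 1 - t by rewrite ler_piMl ?subr_ge0.
by move: H t0; lra.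
Qed.

(** The tube q - t N (q) with q near [p] and 0 < t < delta avoids the
    hypersurface: a chord of direction N (q) would be almost orthogonal to the
    tangent plane at [p], against [chart_strict_bounds].  It is connected by
    paths, being the image of a convex set of parameters. *)
Lemma lower_tube p : carrier M p -> exists2 V : set 'rV[R]_n.+1, open V /\ V p &
  exists2 z0, ~ carrier M z0 & exists2 delta, 0 < delta &
  forall q t, carrier M q -> V q -> 0 < t < delta ->
    connected_component (~` carrier M) z0 (q - t *: unit_normal M q).
Proof.
move=> Mp; have [C C0 CP] := chart_strict_bounds Mp.
(* Slope 1 / (4 C), so that a chord of length t contributes at most t / 4 to
   the normal component. *)
have [|r r0 [rU rP]] := CP (4 * C)^-1; first by rewrite invr_gt0 mulr_gt0.
have [V [Vo Vp] VE] := chart_image_nbhs Mp r0 rU.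
have [Uo Us _ _ _] := chart_patch Mp; have U0 := chart_dom0 Mp.
have Ns := normal_smooth Mp.
have fc u : `|u| < r -> {for u, continuous (chart M p)}.
  move=> /rU Uu; apply: differentiable_continuous.
  exact: smooth_on_differentiable Us Uu.
have Nc u : `|u| < r -> {for u, continuous (unit_normal M \o chart M p)}.
  move=> /rU Uu; apply: differentiable_continuous.
  exact: smooth_on_differentiable Ns Uu.
have [a a0 aV] : exists2 a, 0 < a & forall z, `|z - p| < a -> V z.
  have /nbhs_normP[a a0 aP] : nbhs p V by exact: open_nbhs_nbhs.
  by exists a => // z za; apply: aP; rewrite /= distrC.
have r00 : `|0 : 'rV[R]_n| < r by rewrite normr0.
have [b b0 [br bP]] : exists2 b, 0 < b & b <= r /\ forall u : 'rV[R]_n, `|u| < b ->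
    `|chart M p u - p| < a / 2 /\
    enorm (unit_normal M (chart M p u) - unit_normal M p) <= 4^-1.
  have a20 : 0 < a / 2 by rewrite divr_gt0.
  have /cvgrPdist_lt/(_ _ a20) H1 := fc 0 r00.
  have e0 : 0 < (4 * n.+1%:R)^-1 :> R by rewrite invr_gt0 mulr_gt0.
  have /cvgrPdist_le/(_ _ e0) H2 := Nc 0 r00.
  have : \forall u \near (0 : 'rV[R]_n), `|chart M p 0 - chart M p u| < a / 2 /\
      `|unit_normal M (chart M p 0) - unit_normal M (chart M p u)| <=
        (4 * n.+1%:R)^-1.
    exact: filterI H1 H2.
  move=> /nbhs_norm0P[b /= b0 bP].
  exists (Num.min b r); first by rewrite lt_min b0.
  split => [|u]; first by rewrite ge_min lexx orbT.
  rewrite lt_min => /andP[/bP/= [ua ub] _]; split.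
    by move: ua; rewrite (chart0 Mp) distrC.
  rewrite (le_trans (enorm_le_normr _))// mulrC -ler_pdivlMr// -invfM.
  by move: ub; rewrite (chart0 Mp) distrC.
pose delta := a / 2; have delta0 : 0 < delta by rewrite divr_gt0.
(* A point z of the tube that lies on M is some chart M p u', and the chord
   from chart M p u to it has length t and normal component at least 3 t / 4. *)
have off u t : `|u| < b -> 0 < t < delta ->
    ~ carrier M (chart M p u - t *: unit_normal M (chart M p u)).
  move=> ub /andP[t0 td]; have [ua uN] := bP u ub.
  have ur : `|u| < r by exact: lt_le_trans br.
  have Mu : carrier M (chart M p u) by apply: chart_carrier => //; exact: rU.
  set z := _ - _ => Mz.
  have Vz : V z.
    apply: aV; rewrite /z addrAC (le_lt_trans (ler_normB _ _))//.
    rewrite [a in X in _ < X](splitr a) ltrD// normrZ gtr0_norm//.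
    apply: le_lt_trans td; rewrite ler_piMr ?(ltW t0)//.
    by rewrite (le_trans (normr_le_enorm _))// normal_unit.
  have : (carrier M `&` V) z by split.
  rewrite -VE => -[u' /= u'r zE].
  have [] := rP u u' ur u'r; rewrite zE /z addrAC subrr add0r enormN dotNl normrN.
  rewrite enormZ normal_unit// mulr1 gtr0_norm// dotZl normrM gtr0_norm//.
  set N := unit_normal M (chart M p u) => H1 H2.
  have NN : dot N (unit_normal M p) >= 3 / 4.
    have : `|dot N (N - unit_normal M p)| <= 4^-1.
      rewrite (le_trans (normr_dot_le _ _))// normal_unit// mul1r.
      exact: uN.
    by rewrite dotBr normal_dot// ler_norml => /andP[_]; lra.
  have : t * (3 / 4) <= (4 * C)^-1 * (C * t).
    apply: le_trans (ler_wpM2l _ H1); last by rewrite invr_ge0 mulr_ge0// ltW.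
    apply: le_trans H2; rewrite ler_wpM2l ?(ltW t0)//.
    by rewrite (le_trans NN)// ler_norm.
  have -> : (4 * C)^-1 * (C * t) = t / 4 by field; rewrite gt_eqF.
  by move: t0; lra.
have [V' [V'o V'p] V'E] : exists2 V' : set 'rV[R]_n.+1, open V' /\ V' p &
    chart M p @` [set u | `|u| < b] = carrier M `&` V'.
  apply: chart_image_nbhs => // u ub; apply: rU; exact: lt_le_trans br.
exists V' => //.
have b00 : `|0 : 'rV[R]_n| < b by rewrite normr0.
have d2 : 0 < delta / 2 < delta.
  by rewrite divr_gt0//= ltr_pdivrMr// ltr_pMr// ltr1n.
exists (chart M p 0 - (delta / 2) *: unit_normal M (chart M p 0)).
  exact: off.
exists delta => // q t Mq Vq /andP[t0 td].
have : (carrier M `&` V') q by split.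
rewrite -V'E => -[u /= ub <-{q Mq Vq}].
pose h (s : R) := delta / 2 + s * (t - delta / 2).
pose g (s : R) := chart M p (s *: u) - h s *: unit_normal M (chart M p (s *: u)).
have g0 : g 0 = chart M p 0 - (delta / 2) *: unit_normal M (chart M p 0).
  by rewrite /g /h mul0r addr0 scale0r.
have g1 : g 1 = chart M p u - t *: unit_normal M (chart M p u).
  by rewrite /g /h mul1r [delta / 2 + _]addrC subrK scale1r.
have su (s : R) : 0 <= s <= 1 -> `|s *: u| < b.
  move=> /andP[s0 s1]; rewrite normrZ ger0_norm//.
  by rewrite (le_lt_trans _ ub)// ler_piMl.
rewrite -g0 -g1; apply: path_connected_component => s s01.
  have {}s01 : `|s *: u| < r.
    by apply: lt_le_trans br; apply: su; rewrite in_itv/= in s01.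
  have sc : (fun s : R => s *: u) @ s --> s *: u by apply: cvgZr_tmp; exact: cvg_id.
  apply: cvgB; first exact: (cvg_comp _ _ sc (fc _ s01)).
  apply: cvgZ; last exact: (cvg_comp _ _ sc (Nc _ s01)).
  apply: cvgD; first exact: cvg_cst.
  by apply: cvgMr_tmp; exact: cvg_id.
apply: off; first exact: su.
move/andP: s01 => [s0 s1]; move/andP: d2 => [d20 d2].
have -> : h s = (1 - s) * (delta / 2) + s * t by rewrite /h; ring.
apply/andP; split.
  have [->|s_neq0] := eqVneq s 0; first by rewrite subr0 mul1r mul0r addr0.
  apply: ltr_wpDl; first by rewrite mulr_ge0 ?subr_ge0// ltW.
  by rewrite mulr_gt0// lt_neqAle eq_sym s_neq0.
set b' := Num.max (delta / 2) t.
rewrite (@le_lt_trans _ _ ((1 - s) * b' + s * b'))//.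
  by rewrite lerD// ler_wpM2l ?subr_ge0// le_max lexx ?orbT.
by rewrite -mulrDl subrK mul1r gt_max d2.
Qed.

Definition lower_side_in (W : set 'rV[R]_n.+1) q :=
  \forall t \near (0 : R)^'+, W (q - t *: unit_normal M q).

Lemma nearest_segment_normal z q : carrier M q ->
  (forall q', carrier M q' -> enorm (z - q) <= enorm (z - q')) ->
  ~ carrier M z ->
  exists2 c, c != 0 & z - q = c *: unit_normal M q /\
    forall s, 0 < s <= 1 ->
      connected_component (~` carrier M) z (q + (s * c) *: unit_normal M q).
Proof.
move=> Mq qP Mz; have zqE := nearest_point_normal Mq qP.
set c := dot _ _ in zqE; exists c; last split => // s s01.
  apply/eqP => c0; apply: Mz; suff -> : z = q by [].
  by apply/eqP; rewrite -subr_eq0 zqE c0 scale0r.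
by rewrite -scalerA -zqE; exact: nearest_segment_component.
Qed.

(** The points whose lower side is in the other component W' form an open and
    closed subset of the connected hypersurface.  It contains the nearest point
    to any point of W', since its upper side is in [W] by hypothesis.  So the
    lower side is everywhere in W', and the segment from [q] to [z], which is
    normal to the hypersurface and stays in [W], must leave [q] upwards. *)
Lemma side_normal (W : set 'rV[R]_n.+1) :
  is_convex_side M W -> (forall p, carrier M p -> 0 < mean_curvature M p) ->
  forall z q, W z -> carrier M q ->
    (forall q', carrier M q' -> enorm (z - q) <= enorm (z - q')) ->
  z - q = enorm (z - q) *: unit_normal M q.
Proof.
move=> [Mconn [x [y [Mx My WE WneqW' WW']]] Wup] Hpos z q Wz Mq qP.
set W' := connected_component _ y in WneqW' WW'.
have WMc : W `<=` ~` carrier M by rewrite WE; exact: connected_component_sub.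
have W'Mc : W' `<=` ~` carrier M by exact: connected_component_sub.
have WcompE a : W a -> connected_component (~` carrier M) a = W.
  by rewrite {1}WE => /same_connected_component <-.
have W'compE a : W' a -> connected_component (~` carrier M) a = W'.
  by move=> /same_connected_component <-.
have disj a : W a -> W' a -> False.
  by move=> /WcompE Wa /W'compE W'a; apply: WneqW'; exact: etrans (esym Wa) W'a.
have up p : carrier M p -> \forall t \near (0 : R)^'+, W (p + t *: unit_normal M p).
  move=> Mp; have := Wup p Mp; have H0 := Hpos p Mp.
  set H := mean_curvature M p in H0 *.
  move=> Wt; have {Wt} : \forall t \near (0 : R), 0 < t ->
    W (p + t *: mean_curvature_vector M p) := Wt.
  move=> /nbhs_norm0P[e /= e0 eP]; near=> t.
  have t0 : 0 < t by near: t; exact: nbhs_right_gt.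
  have tH : 0 < t / H by rewrite divr_gt0.
  have tHe : `|t / H| < e.
    rewrite gtr0_norm// ltr_pdivrMr//.
    by near: t; apply: nbhs_right_lt; rewrite mulr_gt0.
  have := eP _ tHe tH.
  by rewrite /mean_curvature_vector scalerA divfK// gt_eqF.
have step (X : set 'rV[R]_n.+1) p c :
    (forall s, 0 < s <= 1 -> X (p + (s * c) *: unit_normal M p)) ->
    (0 < c -> \forall t \near (0 : R)^'+, X (p + t *: unit_normal M p)) /\
    (c < 0 -> lower_side_in X p).
  move=> H; split => c0.
    near=> t; have t0 : 0 < t by near: t; exact: nbhs_right_gt.
    have := H (t / c); rewrite divfK ?gt_eqF//; apply.
    by rewrite divr_gt0//= ler_pdivrMr// mul1r; near: t; exact: nbhs_right_le.
  near=> t; have t0 : 0 < t by near: t; exact: nbhs_right_gt.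
  have := H (t / - c); rewrite invrN mulrN mulNr divfK ?lt_eqF// scaleNr; apply.
  rewrite -mulrN -invrN divr_gt0 ?oppr_gt0//= ler_pdivrMr ?oppr_gt0// mul1r.
  by near: t; apply: nbhs_right_le; rewrite oppr_gt0.
have tube p : carrier M p -> exists2 V : set 'rV[R]_n.+1, open V /\ V p &
    (forall q, carrier M q -> V q -> lower_side_in W q) \/
    (forall q, carrier M q -> V q -> lower_side_in W' q).
  move=> Mp; have [V Vp [z0 Mz0 [delta delta0 zP]]] := lower_tube Mp.
  exists V => //.
  have : (W `|` W') z0 by rewrite -WW'.
  move=> [/WcompE|/W'compE] zE; [left|right] => q' Mq' Vq'; near=> t;
    rewrite -zE; apply: zP => //; apply/andP; split.
  - by near: t; exact: nbhs_right_gt.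
  - by near: t; exact: nbhs_right_lt.
  - by near: t; exact: nbhs_right_gt.
  - by near: t; exact: nbhs_right_lt.
have bdisj p : lower_side_in W p -> lower_side_in W' p -> False.
  move=> H1 H2; near (0 : R)^'+ => t.
  by apply: (@disj (p - t *: unit_normal M p)); near: t.
pose S : set 'rV[R]_n.+1 := [set p | carrier M p /\ lower_side_in W' p].
have S0 : S !=set0.
  have [p Mp pP] := exists_nearest M y.
  have [c c0 [_ seg]] := nearest_segment_normal Mp pP My.
  have [cpos cneg] := step W' p c seg.
  exists p; split => //.
  have [/cneg//|c_gt0|cE] := ltgtP c 0; last by rewrite cE eqxx in c0.
  exfalso; near (0 : R)^'+ => t; apply: (@disj (p + t *: unit_normal M p)); near: t.
    exact: up.
  exact: cpos.
have SM : S = carrier M.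
  apply: Mconn => //.
    exists (\bigcup_(V in [set V | open V /\
        (forall q, carrier M q -> V q -> lower_side_in W' q)]) V).
      by apply: bigcup_open => V [].
    apply/seteqP; split => [p [Mp bp]|p [Mp [V [_ VP] Vp]]]; last first.
      by split => //; exact: VP.
    split => //; have [V [Vo Vp] [VP|VP]] := tube p Mp.
      by exfalso; apply: (@bdisj p) => //; exact: VP.
    by exists V.
  exists (~` \bigcup_(V in [set V | open V /\
      (forall q, carrier M q -> V q -> lower_side_in W q)]) V).
    by apply: open_closedC; apply: bigcup_open => V [].
  apply/seteqP; split => [p [Mp bp]|p [Mp np]].
    by split => // -[V [_ VP] Vp]; apply: (@bdisj p) => //; exact: VP.
  split => //; have [V [Vo Vp] [VP|VP]] := tube p Mp; last exact: VP.
  by exfalso; apply: np; exists V.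
have Mz : ~ carrier M z by exact: WMc.
have [c c0 [zqE seg]] := nearest_segment_normal Mq qP Mz.
have segW s : 0 < s <= 1 -> W (q + (s * c) *: unit_normal M q).
  by move=> s01; rewrite -(WcompE z Wz); exact: seg.
have [_ cneg] := step W q c segW.
have c_gt0 : 0 < c.
  have [/cneg bq|//|cE] := ltgtP c 0; last by rewrite cE eqxx in c0.
  by exfalso; apply: (@bdisj q) => //; have [] : S q by rewrite SM.
by rewrite zqE enormZ normal_unit// mulr1 gtr0_norm.
Unshelve. all: by end_near. Qed.

End Sides.

(** * Comparison of mean curvatures *)

Section Comparison.
Variables (R : realType) (n : nat) (M1 M2 : hypersurface R n).

Lemma hessZ m (f : 'rV[R]_n -> 'rV[R]_m) (c : R) (xi : 'rV[R]_m) :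
  hess f (c *: xi) = c *: hess f xi.
Proof. by apply/matrixP => i j; rewrite !mxE dotZr. Qed.

Lemma enorm_orthogonal_part m (u a : 'rV[R]_m) : dot u u = 1 ->
  enorm (a - dot a u *: u) <= enorm a.
Proof.
move=> u1; rewrite -ler_sqr ?nnegrE ?enorm_ge0// !enorm_sqr.
rewrite !dotBl !dotBr !dotZl !dotZr u1 (dotC u a).
have := sqr_ge0 (dot a u); rewrite expr2; lra.
Qed.

Lemma enorm_le_rho m (x : 'rV[R]_m) : enorm x <= rho x.
Proof. by rewrite -ler_sqr ?nnegrE ?enorm_ge0 ?sqrtr_ge0// rho_sqr enorm_sqr lerDr. Qed.

(** Two nearly parallel hyperplanes: up to sign, [e1] and [e2] differ by O(eps),
    so the correction term II (r, r) of [trace_comparison] is O(eps^2). *)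
Lemma perturbed_trace_comparison (T1 T2 : 'M[R]_(n, n.+1)) (e1 e2 u : 'rV[R]_n.+1)
    (h1 h2 : 'M[R]_n) (m k eps C a1 a2 : R) :
  row_free T1 -> row_free T2 -> T1 *m e1^T = 0 -> T2 *m e2^T = 0 ->
  dot e1 e1 = 1 -> dot e2 e2 = 1 -> h1^T = h1 -> h2^T = h2 ->
  e1 + u = m *: e2 -> enorm u <= eps -> 0 < eps <= 2^-1 -> k <= eps -> 0 <= C ->
  (forall r : 'rV[R]_n, dot (r *m h1) r <= C * enorm (r *m T1) ^+ 2) ->
  \tr (h1 *m invmx (T1 *m T1^T)) = a1 -> \tr (h2 *m invmx (T2 *m T2^T)) = a2 ->
  (forall v w : 'rV[R]_n, w *m T1 = v *m T2 - dot (v *m T2) e1 *: e1 ->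
     dot (w *m h1) w <= m * dot (v *m h2) v + k * dot (v *m T2) (v *m T2)) ->
  a1 <= (1 + eps) * `|a2| + eps * n%:R + 4 * C * eps ^+ 2.
Proof.
move=> T1f T2f T1e T2e e11 e22 h1s h2s muE u_le /andP[eps0 eps2] keps C0 h1C tr1 tr2 H.
have ne1 : enorm e1 = 1 by rewrite /enorm e11 sqrtr1.
have mabs : `|m| = enorm (e1 + u) by rewrite muE enormZ /enorm e22 sqrtr1 mulr1.
have m_le : `|m| <= 1 + eps.
  by rewrite mabs (le_trans (ler_enormD _ _))// ne1 lerD2l.
have m_ge : 2^-1 <= `|m|.
  have : enorm e1 <= enorm (e1 + u) + enorm u.
    have {1}-> : e1 = (e1 + u) + - u by rewrite addrK.
    by rewrite (le_trans (ler_enormD _ _))// enormN.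
  by rewrite ne1 mabs; move: u_le eps2; lra.
have [r rT] := trace_comparison T1f T2f T1e T2e e11 e22 h1s h2s H.
rewrite tr1 tr2 => tr_le.
have rT_le : enorm (r *m T1) <= 2 * eps.
  have mrT : m *: (r *m T1) = u - dot u e1 *: e1.
    rewrite rT scalerBr -muE scalerA -dotZl -muE dotDl e11 scalerDl scale1r.
    by apply/rowP => i; rewrite !mxE; ring.
  (* m r T1 is the part of u orthogonal to e1, and |m| >= 1/2. *)
  have : `|m| * enorm (r *m T1) <= eps.
    by rewrite -enormZ mrT (le_trans (enorm_orthogonal_part _ e11)).
  have := enorm_ge0 (r *m T1); nra.
have II_le : dot (r *m h1) r <= 4 * C * eps ^+ 2.
  rewrite (le_trans (h1C r))//.
  have -> : 4 * C * eps ^+ 2 = C * (2 * eps) ^+ 2 by ring.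
  by rewrite ler_wpM2l// ler_sqr ?nnegrE ?enorm_ge0// mulr_ge0// ltW.
have mH : m * a2 <= (1 + eps) * `|a2|.
  by rewrite (le_trans (ler_norm _))// normrM ler_wpM2r.
have kn : k * n%:R <= eps * n%:R by rewrite ler_wpM2r.
lra.
Qed.

(** The first-order condition at [x] shows that the normal of M2 is close to
    that of M1 up to sign; the second variation then provides the inequality between the
    second fundamental forms whose trace is taken. *)
Lemma curvature_comparison (n_gt0 : (0 < n)%N) x y d eps C :
  carrier M2 x -> carrier M1 y -> 0 < d -> 0 < eps <= 2^-1 -> 0 <= C ->
  x - y = d *: unit_normal M1 y ->
  (forall x' y', carrier M2 x' -> carrier M1 y' ->
    enorm (x - y) + eps * rho x <= enorm (x' - y') + eps * rho x') ->
  shape_norm M1 y <= C ->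
  n%:R * mean_curvature M1 y <=
    (1 + eps) * `|n%:R * mean_curvature M2 x| + eps * n%:R + 4 * C * eps ^+ 2.
Proof.
move=> M2x M1y d0 eps01 C0 xyE xy_min shC; have /andP[eps0 eps2] := eps01.
have nu1 := normal_dot M1y.
have r1 := rho_ge1 x; have r0 : 0 < rho x by exact: lt_le_trans r1.
pose k := eps / rho x; have k0 : 0 < k by rewrite divr_gt0.
have kE : eps = k * rho x by rewrite /k divfK// gt_eqF.
have keps : k <= eps by rewrite kE ler_peMr// ltW.
have mu_orth : forall v : 'rV[R]_n,
    dot (v *m tangent_frame M2 x) (unit_normal M1 y + k *: x) = 0.
  apply: (@first_order_condition _ _ M2 x _ ((2 * d)^-1 + k / 2)) => // x' Mx'.
  have := xy_min x' y Mx' M1y.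
  have -> : x' - y = x' - x + d *: unit_normal M1 y.
    by rewrite -xyE; apply/rowP => i; rewrite !mxE; ring.
  have := rho_le_quadratic x x'; set X := x' - x; clearbody X.
  rewrite xyE enormZ normal_unit// mulr1 gtr0_norm//.
  set z := X + d *: _; have zz : dot z z =
      dot X X + 2 * d * dot X (unit_normal M1 y) + d ^+ 2.
    rewrite /z dotDl !dotDr !dotZl !dotZr nu1 (dotC (unit_normal M1 y)).
    by rewrite expr2; ring.
  (* To first order the cruder bound on the norm of z is enough. *)
  have z_le : enorm z <= (dot z z + d ^+ 2) / (2 * d).
    rewrite ler_pdivlMr ?mulr_gt0// -enorm_sqr.
    have := sqr_ge0 (enorm z - d); rewrite sqrrB; lra.
  rewrite dotDr dotZr; set r := rho x in r0 kE *; set r' := rho x' => H1 H2.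
  have {}H1 : eps * (r' - r) <= k / 2 * (2 * dot X x + dot X X).
    have -> : k / 2 * (2 * dot X x + dot X X) =
        eps * ((2 * r)^-1 * (2 * dot X x + dot X X)).
      by rewrite kE; field; rewrite gt_eqF.
    by rewrite ler_wpM2l// ltW.
  move: z_le; rewrite zz; set a := dot X X in H1 *; set b := dot X (unit_normal M1 y).
  have -> : (a + 2 * d * b + d ^+ 2 + d ^+ 2) / (2 * d) = a * (2 * d)^-1 + b + d.
    by field; rewrite gt_eqF.
  lra.
apply: (perturbed_trace_comparison (tangent_frame_free M1y) (tangent_frame_free M2x)
  (tangent_frame_normal M1y) (tangent_frame_normal M2x) nu1 (normal_dot M2x)
  (second_form_sym M1y) (second_form_sym M2x) (normal_multiple M2x mu_orth) _
  eps01 keps C0 _ (second_form_trace M1y n_gt0) (second_form_trace M2x n_gt0)).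
- by rewrite enormZ gtr0_norm// kE ler_wpM2l ?(ltW k0)// enorm_le_rho.
- move=> r; rewrite (le_trans (ler_norm _))//.
  rewrite (le_trans (second_form_le_shape_norm r M1y))//.
  by rewrite ler_wpM2r ?sqr_ge0.
move=> v w /(second_variation M2x M1y d0 nu1 xyE k0 kE xy_min).
by rewrite {1}(normal_multiple M2x mu_orth) hessZ -scalemxAr dotZl.
Qed.

End Comparison.

(** * Minimising sequences for the distance *)

Section Distance.
Variables (R : realType) (n : nat) (M : hypersurface R n).

Lemma eucl_dist_le x y : carrier M y -> eucl_dist x (carrier M) <= enorm (x - y).
Proof.
move=> My; apply: ge_inf; last by exists y.
by exists 0 => _ [q _ <-]; exact: enorm_ge0.
Qed.

Lemma eucl_dist_ge x b : (forall y, carrier M y -> b <= enorm (x - y)) ->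
  b <= eucl_dist x (carrier M).
Proof.
move=> H; apply: lb_le_inf => [|_ [y My <-]]; last exact: H.
by have [y My] := carrier_neq0 M; exists (enorm (x - y)); exists y.
Qed.

Lemma eucl_dist_ge0 x : 0 <= eucl_dist x (carrier M).
Proof. by apply: eucl_dist_ge => y _; exact: enorm_ge0. Qed.

Lemma eucl_dist_lipschitz x x' :
  eucl_dist x (carrier M) <= eucl_dist x' (carrier M) + enorm (x - x').
Proof.
rewrite -lerBlDr; apply: eucl_dist_ge => y My; rewrite lerBlDr.
by rewrite (le_trans (eucl_dist_le x My))// [leRHS]addrC ler_enormB.
Qed.

Lemma continuous_eucl_dist :
  continuous (fun x : 'rV[R]_n.+1 => eucl_dist x (carrier M)).
Proof.
move=> x; suff : eucl_dist z (carrier M) @[z --> x] --> eucl_dist x (carrier M) by [].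
apply/(cvgrPdist_le (FF := nbhs_filter x)) => e e0.
have : enorm (x - z) @[z --> x] --> enorm (x - x) by exact: continuous_enorm.
move/(cvgrPdist_le (FF := nbhs_filter x)) => /(_ e e0).
apply: filterS => x'; rewrite subrr enorm0 sub0r normrN ger0_norm ?enorm_ge0//.
have := eucl_dist_lipschitz x' x; have := eucl_dist_lipschitz x x'.
by rewrite (enormBC x') ler_norml => H1 H2 H3; apply/andP; split; lra.
Qed.

Lemma continuous_rho m : continuous (@rho R m).
Proof.
move=> x; have d : dot z z @[z --> x] --> dot x x.
  by apply: (cvg_dot (nbhs_filter x)); exact: cvg_id.
have d1 : 1 + dot z z @[z --> x] --> 1 + dot x x.
  exact: (cvgD (cvg_cst (1 : R) (F := nbhs x)) d).
exact: (cvg_comp _ _ d1 (@sqrt_continuous R _)).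
Qed.

End Distance.

Section Minimizers.
Variables (R : realType) (n : nat) (M1 M2 : hypersurface R n).

Lemma perturbed_distance_min eps : 0 < eps -> exists2 x, carrier M2 x &
  forall x', carrier M2 x' -> eucl_dist x (carrier M1) + eps * rho x <=
    eucl_dist x' (carrier M1) + eps * rho x'.
Proof.
move=> eps0; apply: (carrier_min (f := fun x => eucl_dist x (carrier M1) + eps * rho x)).
  move=> x.
  have c1 : eucl_dist z (carrier M1) @[z --> x] --> eucl_dist x (carrier M1).
    exact: continuous_eucl_dist.
  have c2 : eps * rho z @[z --> x] --> eps * rho x.
    have rc : rho z @[z --> x] --> rho x by exact: continuous_rho.
    exact: (cvgM (cvg_cst eps (F := nbhs x)) rc).
  exact: (cvgD c1 c2).
move=> B; exists (B / eps) => x _ H; rewrite ler_pdivlMr// mulrC.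
rewrite (le_trans _ H)// -[leLHS]add0r lerD ?eucl_dist_ge0//.
by rewrite ler_wpM2l ?(ltW eps0)// enorm_le_rho.
Qed.

(** Compare with a fixed almost minimising point [z], for which e j * rho z
    tends to 0. *)
Lemma perturbed_min_minimizing (e : nat -> R) (x : nat -> 'rV[R]_n.+1) :
  (forall j, 0 < e j) -> e @ \oo --> (0 : R) -> (forall j, carrier M2 (x j)) ->
  (forall j x', carrier M2 x' -> eucl_dist (x j) (carrier M1) + e j * rho (x j) <=
    eucl_dist x' (carrier M1) + e j * rho x') ->
  (fun j => eucl_dist (x j) (carrier M1)) @ \oo -->
    inf [set eucl_dist z (carrier M1) | z in carrier M2].
Proof.
move=> e0 el Mx xmin; set D := [set _ | _ in _].
have Dlb : lbound D 0 by move=> _ [z _ <-]; exact: eucl_dist_ge0.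
have Dinf : has_inf D.
  split; last by exists 0.
  by have [z Mz] := carrier_neq0 M2; exists (eucl_dist z (carrier M1)); exists z.
apply/cvgrPdist_le => d d0; have d2 : 0 < d / 2 by rewrite divr_gt0.
have [_ [z Mz <-] zD] := inf_adherent d2 Dinf.
have rz : 0 < rho z by rewrite (lt_le_trans ltr01) ?rho_ge1.
have d2z : 0 < d / 2 / rho z by rewrite divr_gt0.
move/cvgrPdist_lt : el => /(_ _ d2z); apply: filterS => j.
rewrite sub0r normrN gtr0_norm// ltr_pdivlMr// => ej.
have H1 : inf D <= eucl_dist (x j) (carrier M1).
  by apply: ge_inf; [exists 0|exists (x j)].
have H2 := xmin j z Mz.
have H3 : 0 <= e j * rho (x j) by rewrite mulr_ge0 ?sqrtr_ge0// ltW.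
rewrite distrC ger0_norm ?subr_ge0// lerBlDr; lra.
Qed.

End Minimizers.

Lemma limn_esup_fin_bound (R : realType) (u : nat -> R) :
  (limn_esup (fun j => (u j)%:E) < +oo)%E ->
  exists2 C, 0 <= C & \forall j \near \oo, u j <= C.
Proof.
move=> /ereal_inf_lt[_ [V VF <-] Vfin].
pose s := ereal_sup [set (u x)%:E | x in V]; pose C := Num.max 0 (fine s).
have HC : (s <= C%:E)%E.
  rewrite /C; move: Vfin; rewrite -/s; case: (s) => [r| |] //= _; last first.
    by rewrite leNye.
  by rewrite lee_fin le_max lexx orbT.
exists C; first by rewrite le_max lexx.
apply: filterS VF => j Vj; rewrite -lee_fin; apply: le_trans HC.
by apply: ereal_sup_ubound; exists j.
Qed.

Lemma curvature_gap_bounds (R : realType) (n : nat) (M1 M2 : hypersurface R n) :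
  (ereal_sup [set (enorm (mean_curvature_vector M2 x))%:E | x in carrier M2] <
   ereal_inf [set (mean_curvature M1 y)%:E | y in carrier M1])%E ->
  exists h H : R, [/\ 0 <= h, h < H,
    forall x, carrier M2 x -> `|mean_curvature M2 x| <= h &
    forall y, carrier M1 y -> H <= mean_curvature M1 y].
Proof.
set s := ereal_sup _; set i := ereal_inf _ => si.
have sP x : carrier M2 x -> (`|mean_curvature M2 x|%:E <= s)%E.
  move=> Mx; apply: ereal_sup_ubound; exists x => //.
  by rewrite /mean_curvature_vector enormZ normal_unit// mulr1.
have iP y : carrier M1 y -> (i <= (mean_curvature M1 y)%:E)%E.
  by move=> My; apply: ereal_inf_lbound; exists y.
have [x0 Mx0] := carrier_neq0 M2; have [y0 My0] := carrier_neq0 M1.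
have := sP _ Mx0; have := iP _ My0.
move: si sP iP; case: s => [h| |]; case: i => [H| |] //= si sP iP _ h0.
exists h, H; split => //.
by move: h0; rewrite lee_fin; apply: le_trans.
Qed.

Theorem theorem4p3 (R : realType) (n : nat) (n_gt0 : (0 < n)%N)
  (M1 M2 : hypersurface R n)
  (disjoint_M1M2 : carrier M1 `&` carrier M2 = set0)
  (complete_M2 : is_complete M2)
  (R0 : R) (R0_gt0 : 0 < R0)
  (ricci_M2 : ricci_ge M2 (- (n%:R - 1) * R0))
  (shape_bounded : forall x : nat -> 'rV[R]_n.+1,
     (forall j, carrier M2 (x j)) ->
     (fun j => eucl_dist (x j) (carrier M1)) @ \oo -->
       inf [set eucl_dist z (carrier M1) | z in carrier M2] ->
     exists y : nat -> 'rV[R]_n.+1,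
       (forall j, carrier M1 (y j) /\ enorm (x j - y j) = eucl_dist (x j) (carrier M1)) /\
       (limn_esup (fun j => (shape_norm M1 (y j))%:E) < +oo)%E)
  (curvature_gap :
     (ereal_sup [set (enorm (mean_curvature_vector M2 x))%:E |
                 x in carrier M2] <
      ereal_inf [set (mean_curvature M1 y)%:E | y in carrier M1])%E) :
  forall W : set 'rV[R]_n.+1,
    is_convex_side M1 W -> ~ (carrier M2 `<=` W).
Proof.
move=> W convW M2W.
have [h [H [h0 hH H2 H1]]] := curvature_gap_bounds curvature_gap.
have H1pos p : carrier M1 p -> 0 < mean_curvature M1 p.
  by move=> /H1; apply: lt_le_trans; exact: le_lt_trans hH.
(* The factor 1/2 keeps e j in the range where |m| >= 1/2. *)
pose e (j : nat) : R := 2^-1 * j.+1%:R^-1.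
have e0 j : 0 < e j by rewrite mulr_gt0.
have e2 j : e j <= 2^-1 by rewrite ler_piMr// invf_le1// ler1n.
have el : e @ \oo --> (0 : R).
  by rewrite -(mulr0 2^-1); apply: cvgMl_tmp; exact: cvg_harmonic.
have ex j : exists z, carrier M2 z /\ forall x', carrier M2 x' ->
    eucl_dist z (carrier M1) + e j * rho z <= eucl_dist x' (carrier M1) + e j * rho x'.
  by have [z Mz zP] := perturbed_distance_min M1 M2 (e0 j); exists z.
have [x xP] := choice ex.
have Mx j : carrier M2 (x j) by have [] := xP j.
have xmin j := (xP j).2.
have [y [yP /limn_esup_fin_bound[C C0 yC]]] :=
  shape_bounded x Mx (perturbed_min_minimizing e0 el Mx xmin).
have bound j : shape_norm M1 (y j) <= C ->
    n%:R * H <= (1 + e j) * (n%:R * h) + e j * n%:R + 4 * C * e j ^+ 2.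
  move=> yjC; have [My yd] := yP j.
  have near q : carrier M1 q -> enorm (x j - y j) <= enorm (x j - q).
    by move=> Mq; rewrite yd; exact: eucl_dist_le.
  have xy : x j != y j.
    apply/eqP => xyE; have : (carrier M1 `&` carrier M2) (x j).
      by split => //; rewrite xyE.
    by rewrite disjoint_M1M2.
  have nrm := side_normal convW H1pos (M2W _ (Mx j)) My near.
  have d0 : 0 < enorm (x j - y j) by rewrite enorm_gt0// subr_eq0.
  have e01 : 0 < e j <= 2^-1 by rewrite e0 e2.
  have pmin x' y' : carrier M2 x' -> carrier M1 y' ->
      enorm (x j - y j) + e j * rho (x j) <= enorm (x' - y') + e j * rho x'.
    move=> Mx' My'; rewrite yd (le_trans (xmin j x' Mx'))// lerD2r.
    exact: eucl_dist_le.
  have := curvature_comparison n_gt0 (Mx j) My d0 e01 C0 nrm pmin yjC.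
  rewrite normrM ger0_norm// => cmp.
  have nH : n%:R * H <= n%:R * mean_curvature M1 (y j) by rewrite ler_wpM2l// H1.
  have nh : (1 + e j) * (n%:R * `|mean_curvature M2 (x j)|) <= (1 + e j) * (n%:R * h).
    by rewrite !ler_wpM2l// ?H2// addr_ge0// ltW.
  lra.
have n0 : 0 < n%:R :> R by rewrite ltr0n.
have rhs : (1 + e j) * (n%:R * h) + e j * n%:R + 4 * C * e j ^+ 2 @[j --> \oo] -->
    (1 + 0) * (n%:R * h) + 0 * n%:R + 4 * C * 0 ^+ 2.
  apply: cvgD.
    apply: cvgD; last exact: cvgMr_tmp.
    by apply: cvgMr_tmp; apply: cvgD => //; exact: cvg_cst.
  by apply: cvgMl_tmp; rewrite expr2; under eq_fun do rewrite expr2; exact: cvgM.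
have : n%:R * H <= (1 + 0) * (n%:R * h) + 0 * n%:R + 4 * C * 0 ^+ 2.
  by apply: (ler_cvg_to (cvg_cst (n%:R * H)) rhs); apply: filterS yC.
rewrite addr0 mul1r mul0r addr0 expr2 !mulr0 addr0 ler_pM2l//.
by rewrite leNgt hH.
Qed.
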